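(* Let $\delta\in\mathbb{R}$. For any fixed $\nu\ge|\delta|$ and all sufficiently large $k$, $$a'_{\nu,\delta,k}=\pi\left(k+\frac12\nu+\frac14\right)+O_\nu\left(\frac1k\right).$$
   Context: $J_\nu$ is the Bessel function of the first kind of order $\nu$ and $j_{\nu,\delta}(x)=x^{-\delta}J_\nu(x)$ for $x>0$. For $\nu\ge|\delta|$, the positive zeros of $j_{\nu,\delta}'$ are simple and are listed in increasing order as $a'_{\nu,\delta,k}$, with the index $k$ beginning with $k=0$ if $\nu>|\delta|$ and with $k=1$ if $\nu=|\delta|$. The implicit constant may also depend on $\delta$.
   Formalization: For ν = −δ > 0 the zeros are indexed from k = 0 rather than k = 1, since the stated formula is otherwise off by π (e.g. ν = 1/2, δ = −1/2, where j is a multiple of sin x); the index starts at k = 1 only when ν = δ. *)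

(* Defs.v *)
From Stdlib Require Export Reals Factorial.
From Coquelicot Require Export Coquelicot.
Open Scope R_scope.

(* Euler's integral; meaningful for [0 < s]. *)
Definition Gamma (s : R) : R :=
  RInt_gen (fun t => Rpower t (s - 1) * exp (- t))
    (at_right 0) (Rbar_locally p_infty).

(* Meaningful for [-1 < nu] (so that [Gamma] is only used on positive
   arguments) and [0 < x]. *)
Definition BesselJ (nu x : R) : R :=
  Series (fun m : nat =>
    (-1) ^ m / (INR (fact m) * Gamma (INR m + nu + 1))
    * Rpower (x / 2) (2 * INR m + nu)).

Definition besselj (nu delta x : R) : R :=
  Rpower x (- delta) * BesselJ nu x.

Definition next_crit (nu delta c : R) : R :=
  real (Glb_Rbar (fun x => c < x /\ is_derive (besselj nu delta) x 0)).

(* The positive zeros of the derivative of [besselj nu delta], in increasing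
   order, the smallest one having rank 0. *)
Fixpoint crit (nu delta : R) (n : nat) : R :=
  match n with
  | O => next_crit nu delta 0
  | S n' => next_crit nu delta (crit nu delta n')
  end.

(* Index given to the smallest positive zero.  In the case [nu = - delta > 0]
   it has to be 0, not 1: for [nu = 1/2], [delta = -1/2], [besselj nu delta] is
   a multiple of [sin], and the n-th positive zero (n = 0, 1, ...) of its
   derivative is [PI * (n + 1/2) = PI * (n + nu / 2 + 1/4)]. *)
Definition first_index (nu delta : R) : nat :=
  if Req_EM_T nu delta then 1%nat else 0%nat.

(* [a'_{nu,delta,k}], for [first_index nu delta <= k]. *)
Definition aprime (nu delta : R) (k : nat) : R :=
  crit nu delta (k - first_index nu delta).

(* Main.v *)
Require Import Defs.
From Stdlib Require Import Lra Lia Psatz IndefiniteDescription.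

(** Up to a constant, [J_nu] is [cyl nu x = x^nu phi_nu(x^2)] with a power series
    [phi_nu], and the critical points of [x^(-delta) J_nu] are the solutions of
    [x J_nu' = delta J_nu].  Since Lommel's [(x J')^2 + (x^2 - nu^2) J^2] is positive,
    [x J' / J] decreases strictly between zeros of [J], so the critical points
    interlace with the zeros of [J_nu], with one before the first zero exactly when
    [delta < nu].  The choices [delta = nu] and [delta = - nu] give the zeros of
    [J_(nu+1)] and [J_(nu-1)].

    With [u = z^(1/2) J_nu], the phase at infinity comes from following
    [exp(iz) (u' - i u)] along the quarter circle from [r] to [i r]: it varies by
    [O(1/r)], and on the imaginary axis its argument is known because the series is
    real there.
    So zeros and critical points are [O(1/x)]-close to arithmetic progressions of step
    [PI]; it remains to identify the index.  For [1/2 <= nu <= 3/2] Sturm comparison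
    squeezes the zeros between those of orders [1/2] (the sine) and [3/2]; interlacing
    propagates the indexing to all [nu >= 0] and then to the critical points. *)

(** * The Gamma function *)

(** The phase estimate sees a zero only modulo [PI], so no local analysis can say which zero is the
    n-th. A global count is needed, but it only has to be right up to an error strictly below [PI].
    Orders 1/2 and 3/2 serve as comparison functions because the predicted positions of their n-th
    zeros differ by [PI / 2], a window that still singles out one integer, and because order 3/2
    follows from the sine by one interlacing step. Raising the order by one moves the predicted
    zeros by half a step, which is also the offset between zeros and critical points, so the
    numbering travels from order to order without a new count; orders in [0, 1/2) are reached
    downwards from [nu + 1]. A lower bound on u^2 + u'^2, uniform in x >= 1, turns the phase
    estimate, which is an absolute one, into a statement about sin or cos alone. Everything is done
    over the reals: a complex quantity on the arc is a pair of real functions, and z^(2m)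
    contributes r^(2m) cos(2mt) and r^(2m) sin(2mt). *)

(** For a nonnegative integrand the proper integrals grow with the interval, so their supremum is
    the improper integral. The final bound is kept because it later yields positivity of the
    limit. *)
Lemma is_RInt_gen_nonneg (f : R -> R) (M : R) :
  (forall t, 0 < t -> continuous f t) -> (forall t, 0 < t -> 0 <= f t) ->
  (forall a b, 0 < a -> a <= b -> RInt f a b <= M) ->
  exists l, is_RInt_gen f (at_right 0) (Rbar_locally p_infty) l /\
    forall a b, 0 < a -> a <= b -> RInt f a b <= l.
Proof.
  intros Hc Hp HM.
  assert (Hex : forall a b, 0 < a -> 0 < b -> ex_RInt f a b).
  { intros a b Ha Hb. apply (ex_RInt_continuous (V := R_CompleteNormedModule)).
    intros t Ht. apply Hc. apply Rlt_le_trans with (2 := proj1 Ht).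
    now apply Rmin_glb_lt. }
  assert (Hpos : forall a b, 0 < a -> a <= b -> 0 <= RInt f a b).
  { intros a b Ha Hab. apply RInt_ge_0; try apply Hex; try lra.
    intros t Ht. apply Hp. lra. }
  assert (Hmon : forall a b c d, 0 < a -> a <= c -> c <= d -> d <= b ->
             RInt f c d <= RInt f a b).
  { intros a b c d Ha Hac Hcd Hdb.
    rewrite <- (RInt_Chasles f a c b); try (apply Hex; lra).
    rewrite <- (RInt_Chasles f c d b); try (apply Hex; lra).
    unfold plus; simpl.
    generalize (Hpos a c Ha Hac) (Hpos d b ltac:(lra) Hdb). lra. }
  destruct (completeness (fun r => exists a b, 0 < a /\ a <= b /\ r = RInt f a b))
    as [l [Hub Hlub]].
  - exists M. intros r (a & b & Ha & Hab & ->). now apply HM.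
  - exists (RInt f 1 1), 1, 1. repeat split; lra.
  - assert (Hle : forall a b, 0 < a -> a <= b -> RInt f a b <= l).
    { intros a b Ha Hab. apply Hub. now exists a, b. }
    exists l. split; [ | exact Hle].
    intros P [eps HP].
    assert (He : exists a b, 0 < a /\ a <= b /\ l - eps < RInt f a b).
    { apply Classical_Prop.NNPP. intros Hn.
      assert (l <= l - eps); [ | destruct eps; simpl in *; lra].
      apply Hlub. intros r (a & b & Ha & Hab & ->).
      apply Rnot_lt_le. intros Hlt. apply Hn. now exists a, b. }
    destruct He as (a0 & b0 & Ha0 & Hab0 & He).
    unfold filtermapi.
    apply Filter_prod with (Q := fun a => 0 < a < a0) (R := fun b => b0 < b).
    + exists (mkposreal a0 Ha0). intros y Hy Hy0.
      unfold ball in Hy; simpl in Hy; unfold AbsRing_ball, abs, minus, plus, opp in Hy; simpl in Hy.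
      rewrite Rabs_pos_eq in Hy; lra.
    + exists b0. intros x Hx; exact Hx.
    + intros a b Ha Hb. exists (RInt f a b). split.
      * apply (RInt_correct (V := R_CompleteNormedModule)). apply Hex; simpl; lra.
      * apply HP. unfold ball; simpl; unfold AbsRing_ball, abs, minus, plus, opp; simpl.
        assert (H1 : RInt f a0 b0 <= RInt f a b) by (apply Hmon; lra).
        assert (H2 : RInt f a b <= l) by (apply Hle; lra).
        apply Rabs_def1; destruct eps; simpl in *; lra.
Qed.

Lemma Rpower_le_affine (t p : R) : 0 < t -> 0 <= p <= 1 -> Rpower t p <= 1 + t.
Proof.
  intros Ht Hp. destruct (Rle_dec t 1) as [H|H].
  - assert (ln t <= 0). { rewrite <- ln_1. now apply ln_le. }
    apply Rle_trans with 1; [ | lra]. unfold Rpower. rewrite <- exp_0 at 1.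
    destruct (Req_dec (p * ln t) 0) as [E|E].
    + rewrite E. rewrite exp_0; lra.
    + apply Rlt_le, exp_increasing. nra.
  - apply Rle_trans with (Rpower t 1); [apply Rle_Rpower; lra | ].
    rewrite Rpower_1; lra.
Qed.

Lemma is_derive_Rpower_l (p t : R) :
  0 < t -> is_derive (fun t => Rpower t p) t (p * Rpower t (p - 1)).
Proof.
  intros Ht. apply is_derive_Reals. now apply derivable_pt_lim_power.
Qed.

Lemma continuous_Gamma_integrand (s t : R) :
  0 < t -> continuous (fun t => Rpower t (s - 1) * exp (- t)) t.
Proof.
  intros Ht. apply (ex_derive_continuous (V := R_NormedModule)).
  apply (ex_derive_mult (fun t => Rpower t (s - 1)) (fun t => exp (- t))).
  - eexists. now apply is_derive_Rpower_l.
  - auto_derive. exact I.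
Qed.

Lemma is_RInt_gen_Gamma_1_2 (s : R) : 1 <= s <= 2 ->
  exists l, 0 < l /\ is_RInt_gen (fun t => Rpower t (s - 1) * exp (- t))
    (at_right 0) (Rbar_locally p_infty) l.
Proof.
  intros Hs.
  assert (Hpos : forall t, 0 < Rpower t (s - 1) * exp (- t)).
  { intros t. apply Rmult_lt_0_compat; [apply exp_pos | apply exp_pos]. }
  (* The bound 2 is the integral of the majorant (1 + t) exp(-t) over the half-line; the majorant
     applies because 0 <= s - 1 <= 1. *)
  destruct (is_RInt_gen_nonneg (fun t => Rpower t (s - 1) * exp (- t)) 2)
    as [l [Hl Hle]].
  - intros t. apply continuous_Gamma_integrand.
  - intros t _. now apply Rlt_le.
  - intros a b Ha Hab.
    assert (HI : is_RInt (fun t => (1 + t) * exp (- t)) a b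
              (- (b + 2) * exp (- b) - - (a + 2) * exp (- a))).
    { apply (is_RInt_derive (fun t => - (t + 2) * exp (- t))).
      - intros t _. auto_derive; [exact I | ring].
      - intros t _. apply (ex_derive_continuous (V := R_NormedModule)).
        auto_derive. exact I. }
    apply Rle_trans with (RInt (fun t => (1 + t) * exp (- t)) a b).
    + apply RInt_le; trivial.
      * apply (ex_RInt_continuous (V := R_CompleteNormedModule)).
        intros t Ht. apply continuous_Gamma_integrand.
        rewrite Rmin_left in Ht; lra.
      * eexists; exact HI.
      * intros t Ht. apply Rmult_le_compat_r; [apply Rlt_le, exp_pos | ].
        apply Rpower_le_affine; lra.
    + rewrite (is_RInt_unique _ _ _ _ HI).
      assert (0 <= (b + 2) * exp (- b)).
      { apply Rmult_le_pos; [lra | apply Rlt_le, exp_pos]. }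
      assert ((a + 2) * exp (- a) <= 2); [ | lra].
      rewrite exp_Ropp. apply Rmult_le_reg_r with (exp a); [apply exp_pos | ].
      rewrite Rmult_assoc, Rinv_l by (generalize (exp_pos a); lra).
      generalize (exp_ineq1 a ltac:(lra)). lra.
  - exists l. split; [ | exact Hl].
    apply Rlt_le_trans with (2 := Hle 1 2 ltac:(lra) ltac:(lra)).
    apply RInt_gt_0; try lra.
    + intros t _. apply Hpos.
    + intros t Ht. apply continuous_Gamma_integrand. lra.
Qed.

Lemma filterlim_Rpower_exp_pinfty (s : R) :
  filterlim (fun t => - (Rpower t s * exp (- t))) (Rbar_locally p_infty) (locally 0).
Proof.
  apply (is_lim_ext_loc (fun t => - exp (t * (s * (ln t / t) - 1))) _ p_infty 0).
  { exists 0. intros t Ht. unfold Rpower. rewrite <- exp_plus. do 2 f_equal.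
    field. lra. }
  replace (Finite 0) with (Rbar_opp 0) by (simpl; f_equal; ring).
  apply is_lim_opp.
  apply (is_lim_comp exp _ p_infty 0 m_infty).
  - apply is_lim_exp_m.
  - replace m_infty with (Rbar_mult p_infty (s * 0 - 1)%R).
    2: { simpl. destruct (Rle_dec 0 (s * 0 - 1)) as [H|H]; [exfalso; lra | trivial]. }
    apply (is_lim_mult _ _ _ p_infty (s * 0 - 1)%R).
    + apply is_lim_id.
    + apply (is_lim_minus' (fun t => s * (ln t / t)) (fun _ => 1)).
      * apply (is_lim_scal_l _ s p_infty 0). apply is_lim_div_ln_p.
      * apply is_lim_const.
    + simpl. lra.
  - exists 0. intros; discriminate.
Qed.

Lemma filterlim_Rpower_exp_0 (s : R) : 1 <= s ->
  filterlim (fun t => - (Rpower t s * exp (- t))) (at_right 0) (locally 0).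
Proof.
  intros Hs P [eps HP].
  assert (Hd : 0 < Rmin 1 eps) by (apply Rmin_pos; [lra | apply cond_pos]).
  exists (mkposreal _ Hd). intros t Ht Ht0. apply HP.
  unfold ball in *; simpl in *; unfold AbsRing_ball, abs, minus, plus, opp in *; simpl in *.
  rewrite Ropp_0, Rplus_0_r in *. rewrite Rabs_Ropp.
  rewrite (Rabs_pos_eq t) in Ht by lra.
  assert (Ht1 : t < 1) by (apply Rlt_le_trans with (1 := Ht); apply Rmin_l).
  assert (Hte : t < eps) by (apply Rlt_le_trans with (1 := Ht); apply Rmin_r).
  assert (H1 : 0 < Rpower t s) by apply exp_pos.
  assert (H2 : 0 < exp (- t)) by apply exp_pos.
  assert (H3 : exp (- t) < 1) by (rewrite <- exp_0; apply exp_increasing; lra).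
  assert (H4 : Rpower t s <= t).
  { rewrite <- (Rpower_1 t) at 2 by lra. unfold Rpower.
    assert (Hln : ln t < 0) by (rewrite <- ln_1; apply ln_increasing; lra).
    destruct (Req_dec s 1) as [->|Hn]; [lra | ].
    apply Rlt_le, exp_increasing. nra. }
  rewrite Rabs_pos_eq by nra. nra.
Qed.

(** Integration by parts arranged so that convergence at [s + 1] is a conclusion: the derivative of
    -t^s exp(-t) integrates to 0 - 0, and adding [s] times the known integral leaves exactly the
    integrand of order [s + 1]. *)
Lemma is_RInt_gen_Gamma_succ (s l : R) : 1 <= s ->
  is_RInt_gen (fun t => Rpower t (s - 1) * exp (- t)) (at_right 0) (Rbar_locally p_infty) l ->
  is_RInt_gen (fun t => Rpower t (s + 1 - 1) * exp (- t)) (at_right 0) (Rbar_locally p_infty)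
    (s * l).
Proof.
  intros Hs Hl.
  set (h := fun t => - (Rpower t s * exp (- t))).
  set (dh := fun t => - (s * (Rpower t (s - 1) * exp (- t))) + Rpower t s * exp (- t)).
  assert (Hh : forall t, 0 < t -> is_derive h t (dh t)).
  { intros t Ht.
    apply (is_derive_ext (fun t => - (Rpower t s * exp (- t)))); [reflexivity | ].
    replace (dh t) with (opp (plus (mult (s * Rpower t (s - 1)) (exp (- t)))
                                (mult (Rpower t s) (- exp (- t))))).
    2: { unfold opp, plus, mult, dh; simpl; ring. }
    apply (is_derive_opp (V := R_NormedModule)
             (fun t => Rpower t s * exp (- t))).
    apply (is_derive_mult (fun t => Rpower t s) (fun t => exp (- t))).
    - now apply is_derive_Rpower_l.
    - auto_derive; [exact I | ring].
    - intros; apply Rmult_comm. }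
  assert (Hnear : filter_prod (at_right 0) (Rbar_locally p_infty)
            (fun ab => forall x, Rmin (fst ab) (snd ab) <= x -> 0 < x)).
  { apply Filter_prod with (Q := fun a => 0 < a) (R := fun b => 0 < b).
    - exists (mkposreal 1 Rlt_0_1). intros; assumption.
    - exists 0. intros; assumption.
    - intros a b Ha Hb x Hx. apply Rlt_le_trans with (2 := Hx).
      simpl. now apply Rmin_glb_lt. }
  assert (HD : is_RInt_gen (Derive h) (at_right 0) (Rbar_locally p_infty) (0 - 0)).
  { apply is_RInt_gen_Derive.
    - revert Hnear; apply filter_imp. intros ab H x Hx. eexists. apply Hh. apply H, Hx.
    - revert Hnear; apply filter_imp. intros ab H x Hx.
      assert (Hx0 : 0 < x) by apply H, Hx.
      apply continuous_ext_loc with dh.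
      + exists (mkposreal x Hx0). intros u Hu. symmetry. apply is_derive_unique, Hh.
        unfold ball in Hu; simpl in Hu; unfold AbsRing_ball, abs, minus, plus, opp in Hu; simpl in Hu.
        apply Rabs_def2 in Hu. lra.
      + apply (continuous_plus (V := R_NormedModule)).
        * apply (continuous_opp (V := R_NormedModule)).
          apply (continuous_scal_r (V := R_NormedModule) s).
          now apply continuous_Gamma_integrand.
        * apply continuous_ext with (fun t => Rpower t (s + 1 - 1) * exp (- t)).
          { intros u. do 2 f_equal. ring. }
          now apply continuous_Gamma_integrand.
    - now apply filterlim_Rpower_exp_0.
    - apply filterlim_Rpower_exp_pinfty. }
  assert (Hsum := is_RInt_gen_plus _ _ _ _ HD (is_RInt_gen_scal _ s _ Hl)).
  replace (s * l) with (plus (0 - 0) (scal s l)).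
  2: { unfold plus, scal; simpl; unfold mult; simpl; ring. }
  revert Hsum; apply is_RInt_gen_ext.
  revert Hnear; apply filter_imp. intros ab H x Hx.
  rewrite (is_derive_unique _ _ _ (Hh x (H x (Rlt_le _ _ (proj1 Hx))))).
  unfold dh, plus, scal; simpl; unfold mult; simpl.
  replace (s + 1 - 1) with s by ring. ring.
Qed.

(** The range [1 <= s] covers all arguments m + nu + 1 met below. Existence and positivity are
    proved directly on [1, 2] and pushed upwards by the functional equation. *)
Lemma Gamma_correct (s : R) : 1 <= s ->
  0 < Gamma s /\ is_RInt_gen (fun t => Rpower t (s - 1) * exp (- t))
    (at_right 0) (Rbar_locally p_infty) (Gamma s).
Proof.
  intros Hs.
  assert (Hex : forall n s, 1 <= s <= 2 + INR n -> exists l, 0 < l /\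
    is_RInt_gen (fun t => Rpower t (s - 1) * exp (- t)) (at_right 0) (Rbar_locally p_infty) l).
  { clear. induction n as [|n IH]; intros s Hs.
    - simpl in Hs. apply is_RInt_gen_Gamma_1_2. lra.
    - rewrite S_INR in Hs. destruct (Rle_dec s 2) as [H2|H2].
      + apply is_RInt_gen_Gamma_1_2. lra.
      + destruct (IH (s - 1)) as [l [Hl0 Hl]]; [lra | ].
        exists ((s - 1) * l). split; [apply Rmult_lt_0_compat; lra | ].
        apply is_RInt_gen_Gamma_succ in Hl; [ | lra].
        replace (s - 1 + 1) with s in Hl by ring. exact Hl. }
  destruct (nfloor_ex s ltac:(lra)) as [n Hn].
  destruct (Hex n s ltac:(lra)) as [l [Hl0 Hl]].
  unfold Gamma. rewrite (is_RInt_gen_unique _ _ Hl). now split.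
Qed.

Lemma Gamma_pos (s : R) : 1 <= s -> 0 < Gamma s.
Proof. intros Hs. now apply Gamma_correct. Qed.

Lemma Gamma_succ (s : R) : 1 <= s -> Gamma (s + 1) = s * Gamma s.
Proof.
  intros Hs. apply is_RInt_gen_unique. apply is_RInt_gen_Gamma_succ; trivial.
  now apply Gamma_correct.
Qed.

(** * The power series of the Bessel function *)

(** Taylor coefficients of the hypergeometric function 0F1(nu + 1; -t/4), normalised to 1 at t = 0,
    so that [Gamma] enters only through one constant factor of the Bessel function. *)
Fixpoint bcoef (nu : R) (m : nat) : R :=
  match m with
  | O => 1
  | S m' => - bcoef nu m' / (4 * INR (S m') * (INR (S m') + nu))
  end.

Definition phi (nu t : R) : R := PSeries (bcoef nu) t.

Lemma bcoef_S (nu : R) (m : nat) :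
  bcoef nu (S m) = - bcoef nu m / (4 * (INR m + 1) * (INR m + 1 + nu)).
Proof. cbn [bcoef]. now rewrite S_INR. Qed.

Lemma bcoef_neq_0 (nu : R) (m : nat) : 0 <= nu -> bcoef nu m <> 0.
Proof.
  intros Hnu. induction m as [|m IH]; [simpl; lra | ].
  rewrite bcoef_S. generalize (pos_INR m); intros Hm.
  apply Rmult_integral_contrapositive_currified; [lra | ].
  apply Rinv_neq_0_compat. nra.
Qed.

Lemma CV_radius_bcoef (nu : R) : 0 <= nu -> CV_radius (bcoef nu) = p_infty.
Proof.
  intros Hnu. apply CV_radius_infinite_DAlembert.
  - intros n. now apply bcoef_neq_0.
  - apply is_lim_seq_le_le with (u := fun _ => 0) (w := fun n => / INR (S n)).
    + intros n. rewrite S_INR. generalize (pos_INR n); intros Hn.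
      split; [apply Rabs_pos | ].
      rewrite bcoef_S.
      replace (- bcoef nu n / (4 * (INR n + 1) * (INR n + 1 + nu)) / bcoef nu n)
        with (- / (4 * (INR n + 1) * (INR n + 1 + nu))).
      2: { field. repeat split; [lra | lra | now apply bcoef_neq_0]. }
      rewrite Rabs_Ropp, Rabs_pos_eq by (apply Rlt_le, Rinv_0_lt_compat; nra).
      apply Rinv_le_contravar; nra.
    + apply is_lim_seq_const.
    + apply (is_lim_seq_incr_1 (fun n => / INR n)).
      replace (Finite 0) with (Rbar_inv p_infty) by reflexivity.
      apply is_lim_seq_inv; [apply is_lim_seq_INR | discriminate].
Qed.

Lemma ex_pseries_bcoef (nu t : R) : 0 <= nu -> ex_pseries (bcoef nu) t.
Proof.
  intros Hnu. apply CV_disk_correct, CV_disk_inside.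
  now rewrite CV_radius_bcoef.
Qed.

Lemma bcoef_succ_order (nu : R) (m : nat) : 0 <= nu ->
  INR (S m) * bcoef nu (S m) = - / (4 * (nu + 1)) * bcoef (nu + 1) m.
Proof.
  intros Hnu. rewrite bcoef_S, S_INR.
  (* The rising factorials of nu + 1 and nu + 2 differ only in their end factors. *)
  assert (H : bcoef nu m * (nu + 1) = bcoef (nu + 1) m * (INR m + 1 + nu)).
  { induction m as [|m IH]; [simpl; ring | ].
    rewrite !bcoef_S, S_INR. generalize (pos_INR m); intros Hm.
    replace (- bcoef nu m / (4 * (INR m + 1) * (INR m + 1 + nu)) * (nu + 1))
      with (- (bcoef nu m * (nu + 1)) / (4 * (INR m + 1) * (INR m + 1 + nu))).
    2: { field. lra. }
    rewrite IH. field. lra. }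
  generalize (pos_INR m); intros Hm.
  apply Rmult_eq_reg_r with (nu + 1); [ | lra].
  replace ((INR m + 1) * (- bcoef nu m / (4 * (INR m + 1) * (INR m + 1 + nu))) * (nu + 1))
    with (- (bcoef nu m * (nu + 1)) / (4 * (INR m + 1 + nu))).
  2: { field. lra. }
  rewrite H. field. lra.
Qed.

Lemma is_derive_phi (nu t : R) : 0 <= nu ->
  is_derive (phi nu) t (- / (4 * (nu + 1)) * phi (nu + 1) t).
Proof.
  intros Hnu.
  replace (- / (4 * (nu + 1)) * phi (nu + 1) t) with (PSeries (PS_derive (bcoef nu)) t).
  - apply is_derive_PSeries. now rewrite CV_radius_bcoef.
  - unfold phi. rewrite <- PSeries_scal. apply PSeries_ext. intros n.
    unfold PS_derive, PS_scal. rewrite bcoef_succ_order; trivial.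
Qed.

(** The recurrence J_nu + J_(nu+2) = (2 (nu + 1) / x) J_(nu+1) after normalisation. Together with
    the derivative rule it yields both Bessel's equation and the link between orders nu and nu +
    1. *)
Lemma phi_contiguous (nu t : R) : 0 <= nu ->
  (nu + 1) * phi (nu + 1) t - t / (4 * (nu + 2)) * phi (nu + 2) t = (nu + 1) * phi nu t.
Proof.
  intros Hnu.
  assert (H : phi nu t = phi (nu + 1) t - / (4 * (nu + 1) * (nu + 2)) * (t * phi (nu + 2) t)).
  2: { rewrite H. field. lra. }
  unfold phi. rewrite <- PSeries_incr_1.
  unfold Rminus. rewrite Ropp_mult_distr_l, <- PSeries_scal.
  rewrite <- PSeries_plus.
  - apply PSeries_ext. intros [|n]; unfold PS_plus, PS_scal, PS_incr_1, plus, scal;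
      cbn; unfold mult, zero; cbn; [ring | ].
    change (bcoef nu (S n) = bcoef (nu + 1) (S n)
      + - / (4 * (nu + 1) * (nu + 2)) * bcoef (nu + 2) n).
    assert (H1 := bcoef_succ_order nu n Hnu).
    assert (H2 := bcoef_succ_order (nu + 1) n ltac:(lra)).
    replace (nu + 1 + 1) with (nu + 2) in H2 by ring.
    assert (H3 : bcoef (nu + 1) n = - bcoef (nu + 1) (S n) * (4 * INR (S n) * (INR (S n) + nu + 1))).
    { rewrite bcoef_S, S_INR. field. generalize (pos_INR n); lra. }
    assert (Hn : 0 < INR (S n)) by (apply lt_0_INR; lia).
    assert (H4 : bcoef (nu + 2) n = - (4 * (nu + 2)) * (INR (S n) * bcoef (nu + 1) (S n))).
    { rewrite H2. field. lra. }
    rewrite H4. apply Rmult_eq_reg_l with (INR (S n)); [ | lra].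
    rewrite H1, H3. field. lra.
  - apply ex_pseries_bcoef. lra.
  - apply ex_pseries_scal; [intros; apply Rmult_comm | ].
    apply ex_pseries_incr_1, ex_pseries_bcoef. lra.
Qed.

Lemma phi_0 (nu : R) : phi nu 0 = 1.
Proof. unfold phi. now rewrite PSeries_0. Qed.

Lemma phi_half (x : R) : x * phi (1 / 2) (x ^ 2) = sin x.
Proof.
  unfold sin. destruct (exist_sin (Rsqr x)) as [a Ha]. f_equal.
  unfold phi, PSeries. apply is_series_unique. apply is_series_Reals.
  unfold sin_in in Ha. replace (x ^ 2) with (Rsqr x) by (unfold Rsqr; ring).
  assert (Hc : forall n, bcoef (1 / 2) n = sin_n n).
  { clear. induction n as [|n IH].
    - unfold sin_n. simpl. field.
    - rewrite bcoef_S, IH. unfold sin_n.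
      replace (2 * S n + 1)%nat with (S (S (2 * n + 1))) by lia.
      rewrite !fact_simpl, !mult_INR, !S_INR, plus_INR, mult_INR.
      simpl (INR 2); simpl (INR 1). simpl pow.
      generalize (pos_INR n) (INR_fact_neq_0 (2 * n + 1)); intros Hn Hf.
      field. repeat split; trivial; lra. }
  intros eps He. destruct (Ha eps He) as [N HN]. exists N. intros n Hn.
  rewrite (sum_eq _ (fun i => sin_n i * Rsqr x ^ i)); [now apply HN | ].
  intros i _. now rewrite Hc.
Qed.

Lemma BesselJ_phi (nu x : R) : 0 <= nu -> 0 < x ->
  BesselJ nu x = Rpower (x / 2) nu / Gamma (nu + 1) * phi nu (x ^ 2).
Proof.
  intros Hnu Hx. unfold BesselJ, phi, PSeries. rewrite <- Series_scal_l.
  apply Series_ext. intros m.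
  assert (HG : 0 < Gamma (nu + 1)) by (apply Gamma_pos; lra).
  assert (Hp : Rpower (x / 2) (2 * INR m + nu) = (x ^ 2 / 4) ^ m * Rpower (x / 2) nu).
  { rewrite Rpower_plus. f_equal.
    replace (2 * INR m) with (INR (2 * m)) by (rewrite mult_INR; simpl; ring).
    rewrite Rpower_pow by lra. rewrite pow_mult. f_equal. field. }
  assert (Hc : forall m, (-1) ^ m / (INR (fact m) * Gamma (INR m + nu + 1)) * (/ 4) ^ m
                = bcoef nu m / Gamma (nu + 1)).
  { clear - Hnu HG. induction m as [|m IH].
    - simpl. rewrite Rplus_0_l. field. lra.
    - rewrite bcoef_S. rewrite fact_simpl, mult_INR, S_INR. simpl pow.
      generalize (pos_INR m); intros Hm.
      replace (INR m + 1 + nu + 1) with (INR m + nu + 1 + 1) by ring.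
      rewrite Gamma_succ by lra.
      assert (HGm : 0 < Gamma (INR m + nu + 1)) by (apply Gamma_pos; lra).
      replace (- bcoef nu m / (4 * (INR m + 1) * (INR m + 1 + nu)) / Gamma (nu + 1))
        with (- (bcoef nu m / Gamma (nu + 1)) / (4 * (INR m + 1) * (INR m + 1 + nu))).
      2: { field. lra. }
      rewrite <- IH. field. generalize (INR_fact_neq_0 m). lra. }
  rewrite Hp. replace (x ^ 2 / 4) with (/ 4 * x ^ 2) by field.
  rewrite Rpow_mult_distr.
  transitivity ((-1) ^ m / (INR (fact m) * Gamma (INR m + nu + 1)) * (/ 4) ^ m
     * ((x ^ 2) ^ m * Rpower (x / 2) nu)); [ring | ].
  rewrite Hc. field. lra.
Qed.

(** * Real calculus *)

(* [ring] on an equation whose carrier is displayed as a Coquelicot structure over [R]. *)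
Ltac ring_R := match goal with |- ?l = ?r => change (@eq R l r) end; ring.

Lemma is_derive_Rmult (f g : R -> R) (x df dg : R) :
  is_derive f x df -> is_derive g x dg ->
  is_derive (fun t => f t * g t) x (df * g x + f x * dg).
Proof.
  intros Hf Hg. apply (is_derive_mult f g x df dg Hf Hg). intros; apply Rmult_comm.
Qed.

Lemma is_derive_Rplus (f g : R -> R) (x df dg : R) :
  is_derive f x df -> is_derive g x dg ->
  is_derive (fun t => f t + g t) x (df + dg).
Proof. intros Hf Hg. exact (is_derive_plus f g x df dg Hf Hg). Qed.

Lemma is_derive_Rminus (f g : R -> R) (x df dg : R) :
  is_derive f x df -> is_derive g x dg ->
  is_derive (fun t => f t - g t) x (df - dg).
Proof. intros Hf Hg. exact (is_derive_minus f g x df dg Hf Hg). Qed.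

Lemma is_derive_continuity_pt (f : R -> R) (x l : R) :
  is_derive f x l -> continuity_pt f x.
Proof.
  intros H. apply derivable_continuous_pt. exists l. now apply is_derive_Reals.
Qed.

Lemma is_derive_value (f : R -> R) (x l l' : R) :
  is_derive f x l -> l = l' -> is_derive f x l'.
Proof. now intros H <-. Qed.

Lemma MVT_interval (f df : R -> R) (a b : R) : a <= b ->
  (forall x, a <= x <= b -> is_derive f x (df x)) ->
  exists c, a <= c <= b /\ f b - f a = df c * (b - a).
Proof.
  intros Hab Hf. destruct (MVT_gen f a b df) as [c [Hc He]].
  - rewrite Rmin_left, Rmax_right by exact Hab. intros x Hx. apply Hf. lra.
  - rewrite Rmin_left, Rmax_right by exact Hab. intros x Hx.
    apply (is_derive_continuity_pt _ _ (df x)). now apply Hf.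
  - rewrite Rmin_left, Rmax_right in Hc by exact Hab. now exists c.
Qed.

Lemma nondecreasing_of_derive (f df : R -> R) (a b : R) : a <= b ->
  (forall x, a <= x <= b -> is_derive f x (df x)) ->
  (forall x, a <= x <= b -> 0 <= df x) -> f a <= f b.
Proof.
  intros Hab Hf Hd. destruct (MVT_interval f df a b Hab Hf) as [c [Hc He]].
  specialize (Hd c Hc). nra.
Qed.

Lemma increasing_of_derive (f df : R -> R) (a b : R) : a < b ->
  (forall x, a <= x <= b -> is_derive f x (df x)) ->
  (forall x, a <= x <= b -> 0 < df x) -> f a < f b.
Proof.
  intros Hab Hf Hd. destruct (MVT_interval f df a b (Rlt_le _ _ Hab) Hf) as [c [Hc He]].
  specialize (Hd c Hc). nra.
Qed.

Lemma IVT_opposite_signs (f : R -> R) (a b : R) : a < b ->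
  (forall x, a <= x <= b -> continuity_pt f x) ->
  f a * f b < 0 -> exists c, a < c < b /\ f c = 0.
Proof.
  intros Hab Hc Hs.
  assert (Ha := is_lim_continuity f a (Hc a ltac:(lra))).
  assert (Hb := is_lim_continuity f b (Hc b ltac:(lra))).
  assert (Hi : forall x : R, Rbar_lt a x -> Rbar_lt x b -> continuity_pt f x).
  { simpl. intros x H1 H2. apply Hc. lra. }
  destruct (Rlt_dec (f a) 0) as [H|H].
  - destruct (IVT_Rbar_incr f a b _ _ 0 Ha Hb Hi Hab) as [c Hcc].
    { simpl. split; nra. }
    exists c. simpl in Hcc. tauto.
  - destruct (IVT_Rbar_decr f a b _ _ 0 Ha Hb Hi Hab) as [c Hcc].
    { apply Rnot_lt_le in H. assert (f a <> 0) by (intros E; rewrite E in Hs; lra).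
      simpl. split; nra. }
    exists c. simpl in Hcc. tauto.
Qed.

Lemma constant_sign (f : R -> R) (a b : R) : a <= b ->
  (forall x, a <= x <= b -> continuity_pt f x) ->
  (forall x, a <= x <= b -> f x <> 0) -> 0 < f a * f b.
Proof.
  intros Hab Hc Hn. destruct (Rlt_dec 0 (f a * f b)) as [H|H]; trivial.
  assert (Ha := Hn a ltac:(lra)). assert (Hb := Hn b ltac:(lra)).
  assert (f a * f b <> 0) by now apply Rmult_integral_contrapositive_currified.
  destruct (Req_dec a b) as [E|E]; [subst; nra | ].
  destruct (IVT_opposite_signs f a b) as [c [Hc1 Hc2]]; trivial; try lra.
  exfalso. apply (Hn c); lra.
Qed.

Lemma continuity_pt_pos (k : R -> R) (x : R) : continuity_pt k x -> 0 < k x ->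
  exists eps, 0 < eps /\ forall t, Rabs (t - x) < eps -> 0 < k t.
Proof.
  intros Hc Hk. destruct (Hc (k x) Hk) as [d [Hd H]].
  exists d. split; [exact Hd | ]. intros t Ht.
  destruct (Req_dec x t) as [<-|Hn]; trivial.
  assert (Hdist : R_dist (k t) (k x) < k x).
  { apply H. repeat split; trivial. }
  unfold R_dist in Hdist. apply Rabs_def2 in Hdist. lra.
Qed.

Lemma derive_nonpos_of_pos_left (f : R -> R) (a b l : R) : a < b ->
  is_derive f b l -> f b = 0 -> (forall x, a < x < b -> 0 < f x) -> l <= 0.
Proof.
  intros Hab Hd Hb Hp. apply Rnot_lt_le. intros Hl.
  apply is_derive_Reals in Hd. destruct (Hd (l / 2) ltac:(lra)) as [d Hdd].
  set (h := - Rmin (d / 2) ((b - a) / 2)).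
  assert (Hm : 0 < Rmin (d / 2) ((b - a) / 2)).
  { apply Rmin_pos; [ destruct d; simpl; lra | lra]. }
  assert (Hm1 := Rmin_l (d / 2) ((b - a) / 2)).
  assert (Hm2 := Rmin_r (d / 2) ((b - a) / 2)).
  assert (H := Hdd h). rewrite Hb in H. unfold h in *.
  rewrite Rabs_Ropp, (Rabs_pos_eq (Rmin _ _)) in H by lra.
  specialize (H ltac:(lra) ltac:(destruct d; simpl in *; lra)).
  specialize (Hp (b + - Rmin (d / 2) ((b - a) / 2)) ltac:(lra)).
  set (m := Rmin (d / 2) ((b - a) / 2)) in *.
  assert ((f (b + - m) - 0) / - m < 0).
  { unfold Rdiv. rewrite Rminus_0_r, Rinv_opp.
    assert (0 < / m) by now apply Rinv_0_lt_compat. nra. }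
  apply Rabs_def2 in H. lra.
Qed.

Lemma derive_nonneg_of_pos_right (f : R -> R) (a b l : R) : a < b ->
  is_derive f a l -> f a = 0 -> (forall x, a < x < b -> 0 < f x) -> 0 <= l.
Proof.
  intros Hab Hd Ha Hp.
  cut (- l <= 0); [lra | ].
  apply (derive_nonpos_of_pos_left (fun x => f (- x)) (- b) (- a)).
  - lra.
  - apply (is_derive_value _ _ (scal (-1) l)).
    + apply (is_derive_comp f (fun x => - x) (- a) l (-1)).
      * now rewrite Ropp_involutive.
      * auto_derive; [exact I | ring].
    + unfold scal; simpl; unfold mult; simpl; ring.
  - now rewrite Ropp_involutive.
  - intros x Hx. apply Hp. lra.
Qed.

(** * The Bessel equation as a first-order system *)

Definition cyl (nu x : R) : R := Rpower x nu * phi nu (x ^ 2).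

(* [x] times the derivative of [cyl nu] at [x]. *)
Definition cyl1 (nu x : R) : R :=
  Rpower x nu * (nu * phi nu (x ^ 2) - x ^ 2 / (2 * (nu + 1)) * phi (nu + 1) (x ^ 2)).

(** Bessel's equation x (x u')' = (p - x^2) u, with [u1] standing for x u' and [p] for the square of
    the order. This form involves first derivatives only and is linear in the pair. *)
Definition bessel_system (p : R) (u u1 : R -> R) : Prop :=
  forall x, 0 < x -> is_derive u x (u1 x / x) /\ is_derive u1 x ((p - x ^ 2) / x * u x).

Lemma is_derive_phi_sqr (nu x : R) : 0 <= nu ->
  is_derive (fun x => phi nu (x ^ 2)) x (- x / (2 * (nu + 1)) * phi (nu + 1) (x ^ 2)).
Proof.
  intros Hnu.
  apply (is_derive_value _ _ (scal (2 * x) (- / (4 * (nu + 1)) * phi (nu + 1) (x ^ 2)))).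
  - apply (is_derive_comp (phi nu) (fun x => x ^ 2)).
    + now apply is_derive_phi.
    + auto_derive; [exact I | ring].
  - unfold scal; simpl; unfold mult; simpl; field; lra.
Qed.

Lemma cyl_system (nu : R) : 0 <= nu -> bessel_system (nu ^ 2) (cyl nu) (cyl1 nu).
Proof.
  intros Hnu x Hx.
  assert (HR : Rpower x (nu - 1) = Rpower x nu / x).
  { unfold Rminus. rewrite Rpower_plus, Rpower_Ropp, Rpower_1 by lra. reflexivity. }
  split.
  - unfold cyl. eapply is_derive_value.
    + apply is_derive_Rmult; [now apply is_derive_Rpower_l | now apply is_derive_phi_sqr].
    + unfold cyl1. rewrite HR. field. lra.
  - unfold cyl1. eapply is_derive_value.
    + apply is_derive_Rmult; [now apply is_derive_Rpower_l | ].
      apply is_derive_Rminus.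
      * apply is_derive_Rmult; [apply (is_derive_const (V := R_NormedModule)) | ].
        now apply is_derive_phi_sqr.
      * apply is_derive_Rmult; [ | apply is_derive_phi_sqr; lra].
        instantiate (1 := x / (nu + 1)). auto_derive; [exact I | field; lra].
    + unfold cyl, zero; simpl. rewrite HR.
      assert (H := phi_contiguous nu (x ^ 2) Hnu).
      replace (nu + 1 + 1) with (nu + 2) by ring.
      simpl in H.
      set (f2 := phi (nu + 2) _) in *. set (f1 := phi (nu + 1) _) in *.
      set (f0 := phi nu _) in *.
      replace f0 with (((nu + 1) * f1 - x * (x * 1) / (4 * (nu + 2)) * f2) / (nu + 1)).
      2: { rewrite H. field. lra. }
      field. lra.
Qed.

Ltac ex_derive_phi :=
  auto_derive; repeat split; eexists; apply is_derive_phi; lra.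

(** The tool for the singular point 0: a quantity is written as a power of x times a function
    regular at 0, whose value there decides the sign. *)
Lemma pos_near_0 (k : R -> R) : ex_derive k 0 -> 0 < k 0 ->
  exists eps, 0 < eps /\ forall x, 0 < x < eps -> 0 < k x.
Proof.
  intros [l Hl] Hk. destruct (continuity_pt_pos k 0) as [e [He H]]; trivial.
  - now apply is_derive_continuity_pt with l.
  - exists e. split; trivial. intros x Hx. apply H. rewrite Rabs_pos_eq; lra.
Qed.

Lemma pow_0_2 : 0 ^ 2 = 0.
Proof. ring. Qed.

(* Lommel's identity: this quantity is [2 * RInt (fun t => t * cyl nu t ^ 2) 0 x]. *)
Lemma lommel_pos (nu x : R) : 0 <= nu -> 0 < x ->
  0 < cyl1 nu x ^ 2 + (x ^ 2 - nu ^ 2) * cyl nu x ^ 2.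
Proof.
  intros Hnu Hx.
  set (E := fun x => cyl1 nu x ^ 2 + (x ^ 2 - nu ^ 2) * cyl nu x ^ 2).
  (* The terms in nu^2 cancel, which leaves a factor x^(2 nu + 2) times [k], with k(0) = 1 - nu /
     (nu + 1) > 0. This gives positivity near 0, and E' = 2 x cyl^2 >= 0 carries it to every x. *)
  set (k := fun x => phi nu (x ^ 2) * phi nu (x ^ 2)
      - nu / (nu + 1) * (phi nu (x ^ 2) * phi (nu + 1) (x ^ 2))
      + x ^ 2 / (4 * (nu + 1) ^ 2) * (phi (nu + 1) (x ^ 2) * phi (nu + 1) (x ^ 2))).
  assert (Ek : forall x, E x = (Rpower x nu * x) ^ 2 * k x).
  { intros t. unfold E, k, cyl, cyl1. field. lra. }
  destruct (pos_near_0 k) as [e [He Hk]].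
  - unfold k. ex_derive_phi.
  - unfold k. rewrite pow_0_2, !phi_0.
    replace (_ + _) with (/ (nu + 1)) by (field; lra). apply Rinv_0_lt_compat; lra.
  - assert (Hmin := Rmin_l x (e / 2)). assert (Hmin2 := Rmin_r x (e / 2)).
    assert (Hmp : 0 < Rmin x (e / 2)) by (apply Rmin_pos; lra).
    set (a := Rmin x (e / 2)) in *.
    apply Rlt_le_trans with (E a).
    + rewrite Ek. apply Rmult_lt_0_compat.
      * apply pow_lt, Rmult_lt_0_compat; [apply exp_pos | lra].
      * apply Hk. lra.
    + apply (nondecreasing_of_derive E (fun t => 2 * t * cyl nu t ^ 2)); trivial.
      * intros t Ht. destruct (cyl_system nu Hnu t ltac:(lra)) as [H0 H1].
        apply (is_derive_ext (fun x => cyl1 nu x * cyl1 nu x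
                 + (x ^ 2 - nu ^ 2) * (cyl nu x * cyl nu x))).
        { intros u. unfold E.
          ring_R. }
        assert (H2 : is_derive (fun x => x ^ 2 - nu ^ 2) t (2 * t)).
        { auto_derive; [exact I | ring]. }
        eapply is_derive_value.
        -- apply is_derive_Rplus; [exact (is_derive_Rmult _ _ _ _ _ H1 H1) | ].
           exact (is_derive_Rmult _ _ _ _ _ H2 (is_derive_Rmult _ _ _ _ _ H0 H0)).
        -- cbv beta. field. lra.
      * intros t Ht. apply Rmult_le_pos; [lra | apply pow2_ge_0].
Qed.

(** Simplicity of the zeros, read off from Lommel's quantity, which would vanish at a double
    zero. *)
Lemma cyl1_neq_0 (nu x : R) : 0 <= nu -> 0 < x -> cyl nu x = 0 -> cyl1 nu x <> 0.
Proof.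
  intros Hnu Hx H H1. assert (HE := lommel_pos nu x Hnu Hx). rewrite H, H1 in HE. nra.
Qed.

Lemma continuity_cyl (nu x : R) : 0 <= nu -> 0 < x -> continuity_pt (cyl nu) x.
Proof.
  intros Hnu Hx.
  exact (is_derive_continuity_pt _ _ _ (proj1 (cyl_system nu Hnu x Hx))).
Qed.

Lemma continuity_cyl1 (nu x : R) : 0 <= nu -> 0 < x -> continuity_pt (cyl1 nu) x.
Proof.
  intros Hnu Hx.
  exact (is_derive_continuity_pt _ _ _ (proj2 (cyl_system nu Hnu x Hx))).
Qed.

Lemma log_derivative_decreasing (nu a b : R) : 0 <= nu -> 0 < a < b ->
  (forall x, a <= x <= b -> cyl nu x <> 0) ->
  cyl1 nu b / cyl nu b < cyl1 nu a / cyl nu a.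
Proof.
  intros Hnu Hab Hn. apply Ropp_lt_cancel.
  apply (increasing_of_derive (fun x => - (cyl1 nu x / cyl nu x))
           (fun x => (cyl1 nu x ^ 2 + (x ^ 2 - nu ^ 2) * cyl nu x ^ 2) / (x * cyl nu x ^ 2))).
  - lra.
  - intros x Hx. destruct (cyl_system nu Hnu x ltac:(lra)) as [H0 H1].
    assert (Hxn := Hn x Hx).
    assert (Hq := is_derive_opp (fun x => cyl1 nu x / cyl nu x) x _
              (is_derive_div _ _ x _ _ H1 H0 Hxn)).
    eapply is_derive_value; [exact Hq | ].
    unfold opp; simpl. field. lra.
  - intros x Hx. apply Rdiv_lt_0_compat.
    + apply lommel_pos; lra.
    + apply Rmult_lt_0_compat; [lra | ]. apply pow2_gt_0. now apply Hn.
Qed.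

Lemma cyl_pos_near_0 (nu : R) : 0 <= nu ->
  exists eps, 0 < eps /\ forall x, 0 < x < eps -> 0 < cyl nu x.
Proof.
  intros Hnu. destruct (pos_near_0 (fun x => phi nu (x ^ 2))) as [e [He H]].
  - ex_derive_phi.
  - rewrite pow_0_2, phi_0. lra.
  - exists e. split; trivial. intros x Hx. apply Rmult_lt_0_compat; [apply exp_pos | ].
    now apply H.
Qed.

(** * Sturm comparison and enumeration of zeros *)

(** The Wronskian W = u v1 - u1 v has derivative (q - p) u v / x >= 0, yet W(b) = u(b) v1(b) < 0.
    The contradiction comes from the left end: W(a) >= 0 at a zero of v, or, at the singular point
    0, W > 0 arbitrarily close to it. *)
Lemma sturm_core (p q a b : R) (u u1 v v1 : R -> R) :
  bessel_system p u u1 -> bessel_system q v v1 -> p < q -> 0 <= a < b ->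
  (forall x, a < x <= b -> 0 < u x) -> (forall x, a < x < b -> 0 < v x) ->
  v b = 0 -> v1 b <> 0 ->
  (0 < a /\ v a = 0 \/ forall e, 0 < e -> exists x, a < x < e /\ u1 x * v x - u x * v1 x < 0) ->
  False.
Proof.
  intros Hu Hv Hpq Hab Hup Hvp Hvb Hvb1 Ha.
  set (W := fun x => u x * v1 x - u1 x * v x).
  assert (HW : forall x, 0 < x -> is_derive W x ((q - p) / x * (u x * v x))).
  { intros x Hx. destruct (Hu x Hx) as [H0 H1]. destruct (Hv x Hx) as [H2 H3].
    eapply is_derive_value.
    - exact (is_derive_Rminus _ _ _ _ _ (is_derive_Rmult _ _ _ _ _ H0 H3)
               (is_derive_Rmult _ _ _ _ _ H1 H2)).
    - cbv beta. field. lra. }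
  assert (Hd : forall x, a < x <= b -> 0 <= (q - p) / x * (u x * v x)).
  { intros x Hx. apply Rmult_le_pos.
    - apply Rdiv_le_0_compat; lra.
    - apply Rmult_le_pos; [apply Rlt_le, Hup; lra | ].
      destruct (Req_dec x b) as [->|Hn]; [lra | apply Rlt_le, Hvp; lra]. }
  assert (HWb : W b < 0).
  { unfold W. rewrite Hvb.
    assert (v1 b / b <= 0).
    { apply (derive_nonpos_of_pos_left v a b); trivial; try lra.
      apply Hv; lra. }
    assert (v1 b <= 0).
    { replace (v1 b) with (v1 b / b * b) by (field; lra). nra. }
    assert (0 < u b) by (apply Hup; lra). nra. }
  assert (Hmon : forall x, a < x <= b -> W x < 0).
  { intros x Hx. apply Rle_lt_trans with (2 := HWb).
    apply (nondecreasing_of_derive W (fun x => (q - p) / x * (u x * v x))); try lra.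
    - intros t Ht. apply HW. lra.
    - intros t Ht. apply Hd. lra. }
  destruct Ha as [[Ha Hva]|Ha].
  - assert (Hv1a : 0 <= v1 a / a).
    { apply (derive_nonneg_of_pos_right v a b); trivial; try lra.
      apply Hv; lra. }
    assert (0 <= v1 a).
    { replace (v1 a) with (v1 a / a * a) by (field; lra). nra. }
    (* Positivity of [u] is given only to the right of [a]; continuity passes the weak inequality to
       [a] itself. *)
    assert (Hua : 0 <= u a).
    { apply Rnot_lt_le. intros Hn.
      destruct (continuity_pt_pos (fun x => - u x) a) as [e [He H']]; try lra.
      - apply continuity_pt_opp. exact (is_derive_continuity_pt _ _ _ (proj1 (Hu a Ha))).
      - assert (0 < Rmin (e / 2) (b - a)) by (apply Rmin_pos; lra).
        assert (H1 := Rmin_l (e / 2) (b - a)). assert (H2 := Rmin_r (e / 2) (b - a)).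
        set (d := Rmin (e / 2) (b - a)) in *.
        specialize (H' (a + d)). specialize (Hup (a + d) ltac:(lra)).
        replace (a + d - a) with d in H' by ring. rewrite Rabs_pos_eq in H' by lra.
        specialize (H' ltac:(lra)). lra. }
    assert (HWa : 0 <= W a) by (unfold W; rewrite Hva; nra).
    assert (W a <= W b); [ | lra].
    apply (nondecreasing_of_derive W (fun x => (q - p) / x * (u x * v x))); try lra.
    + intros t Ht. apply HW. lra.
    + intros t Ht. destruct (Req_dec t a) as [->|Hn]; [rewrite Hva; lra | apply Hd; lra].
  - destruct (Ha b) as [x [Hx HWx]]; [lra | ].
    specialize (Hmon x ltac:(lra)). unfold W in Hmon. lra.
Qed.

Lemma bessel_system_scal (e p : R) (u u1 : R -> R) : bessel_system p u u1 ->
  bessel_system p (fun x => e * u x) (fun x => e * u1 x).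
Proof.
  intros H x Hx. destruct (H x Hx) as [H0 H1].
  split; eapply is_derive_value.
  - exact (is_derive_scal u x e _ H0).
  - field. lra.
  - exact (is_derive_scal u1 x e _ H1).
  - field. lra.
Qed.

(** Here [P] is an interval of any kind. Multiplying by the value at one point normalises a function
    without zeros to be positive, so later proofs need not split on its sign. *)
Lemma constant_sign_witness (f : R -> R) (P : R -> Prop) (x0 : R) :
  P x0 -> (forall x y z, P x -> P z -> x <= y <= z -> P y) ->
  (forall x, P x -> continuity_pt f x) -> (forall x, P x -> f x <> 0) ->
  forall x, P x -> 0 < f x0 * f x.
Proof.
  intros H0 Hconv Hc Hn x Hx. destruct (Rle_dec x0 x) as [H|H].
  - apply constant_sign; trivial; intros t Ht; [apply Hc | apply Hn];
      now apply (Hconv x0 t x).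
  - rewrite Rmult_comm. apply constant_sign; try lra; intros t Ht; [apply Hc | apply Hn];
      now apply (Hconv x t x0).
Qed.

Lemma sturm_comparison (nu nu' a b : R) : 0 <= nu < nu' -> 0 <= a < b ->
  a = 0 \/ cyl nu' a = 0 -> cyl nu' b = 0 -> (forall x, a < x < b -> cyl nu' x <> 0) ->
  exists c, a < c <= b /\ cyl nu c = 0.
Proof.
  intros Hnu Hab Ha Hb Hn. apply Classical_Prop.NNPP. intros Hno.
  assert (Hnz : forall x, a < x <= b -> cyl nu x <> 0).
  { intros x Hx E. apply Hno. now exists x. }
  set (m := (a + b) / 2).
  assert (Hsu : forall x, a < x <= b -> 0 < cyl nu m * cyl nu x).
  { apply constant_sign_witness.
    - unfold m; lra.
    - intros; lra.
    - intros x Hx. apply continuity_cyl; lra.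
    - exact Hnz. }
  assert (Hsv : forall x, a < x < b -> 0 < cyl nu' m * cyl nu' x).
  { apply constant_sign_witness.
    - unfold m; lra.
    - intros; lra.
    - intros x Hx. apply continuity_cyl; lra.
    - exact Hn. }
  apply (sturm_core (nu ^ 2) (nu' ^ 2) a b
           (fun x => cyl nu m * cyl nu x) (fun x => cyl nu m * cyl1 nu x)
           (fun x => cyl nu' m * cyl nu' x) (fun x => cyl nu' m * cyl1 nu' x)); trivial.
  - apply bessel_system_scal, cyl_system. lra.
  - apply bessel_system_scal, cyl_system. lra.
  - nra.
  - rewrite Hb. ring.
  - apply Rmult_integral_contrapositive_currified.
    + apply Hn. unfold m; lra.
    + apply cyl1_neq_0; lra.
  - destruct (Req_dec a 0) as [Ea|Ea].
    2: { left. split; [lra | ]. destruct Ha as [Ha|Ha]; [lra | rewrite Ha; ring]. }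
    right. intros e He.
    (* The Wronskian at 0: it equals x^(nu + nu') times [k], up to the normalising constants, and
       k(0) = nu' - nu > 0. *)
    set (k := fun x => phi nu (x ^ 2) * (nu' * phi nu' (x ^ 2)
                - x ^ 2 / (2 * (nu' + 1)) * phi (nu' + 1) (x ^ 2))
              - (nu * phi nu (x ^ 2) - x ^ 2 / (2 * (nu + 1)) * phi (nu + 1) (x ^ 2))
                * phi nu' (x ^ 2)).
    destruct (pos_near_0 k) as [e1 [He1 Hk]].
    { unfold k. ex_derive_phi. }
    { unfold k. rewrite pow_0_2, !phi_0. lra. }
    destruct (cyl_pos_near_0 nu) as [e2 [He2 Hc2]]; [lra | ].
    destruct (cyl_pos_near_0 nu') as [e3 [He3 Hc3]]; [lra | ].
    set (d := Rmin (Rmin e b) (Rmin e1 (Rmin e2 e3)) / 2).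
    assert (Hd : 0 < d /\ d < e /\ d < b /\ d < e1 /\ d < e2 /\ d < e3).
    { unfold d.
      assert (H1 := Rmin_l (Rmin e b) (Rmin e1 (Rmin e2 e3))).
      assert (H2 := Rmin_r (Rmin e b) (Rmin e1 (Rmin e2 e3))).
      assert (H3 := Rmin_l e1 (Rmin e2 e3)). assert (H4 := Rmin_r e1 (Rmin e2 e3)).
      assert (H5 := Rmin_l e2 e3). assert (H6 := Rmin_r e2 e3).
      assert (H7 := Rmin_l e b). assert (H8 := Rmin_r e b).
      assert (0 < Rmin (Rmin e b) (Rmin e1 (Rmin e2 e3))).
      { repeat apply Rmin_pos; lra. }
      lra. }
    clearbody d. exists d. split; [lra | ].
    assert (Hcu := Hc2 d ltac:(lra)). assert (Hcv := Hc3 d ltac:(lra)).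
    assert (Hmu := Hsu d ltac:(lra)). assert (Hmv := Hsv d ltac:(lra)).
    assert (Hmu' : 0 < cyl nu m) by nra. assert (Hmv' : 0 < cyl nu' m) by nra.
    assert (Hkd := Hk d ltac:(lra)).
    replace (_ - _) with (- (cyl nu m * cyl nu' m * (Rpower d nu * Rpower d nu' * k d))).
    2: { unfold k. generalize (cyl nu m) (cyl nu' m). intros c c'. unfold cyl, cyl1. ring. }
    apply Ropp_lt_gt_0_contravar, Rmult_lt_0_compat; [now apply Rmult_lt_0_compat | ].
    apply Rmult_lt_0_compat; trivial.
    apply Rmult_lt_0_compat; apply exp_pos.
Qed.

(** The sequence lists all positive elements of [P] below its supremum, which may be finite.
    Divergence is added separately in [enumerates], because for orders between 1/2 and 3/2 it comes
    from comparing an already constructed list with the zeros of the sine. *)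
Record consecutive (P : R -> Prop) (z : nat -> R) : Prop := {
  consecutive_pos : 0 < z O;
  consecutive_incr : forall n, z n < z (S n);
  consecutive_in : forall n, P (z n);
  consecutive_gap0 : forall x, 0 < x < z O -> ~ P x;
  consecutive_gap : forall n x, z n < x < z (S n) -> ~ P x
}.

Definition enumerates (P : R -> Prop) (z : nat -> R) : Prop :=
  consecutive P z /\ forall M, exists n, M < z n.

Lemma consecutive_positive (P : R -> Prop) (z : nat -> R) (n : nat) :
  consecutive P z -> 0 < z n.
Proof.
  intros H. induction n as [|n IH]; [apply H | ].
  apply Rlt_trans with (1 := IH). apply H.
Qed.

Lemma consecutive_ext (P Q : R -> Prop) (z : nat -> R) :
  (forall x, 0 < x -> P x <-> Q x) -> consecutive P z -> consecutive Q z.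
Proof.
  intros HPQ H. split; try apply H.
  - intros n. apply HPQ; [now apply consecutive_positive with P | apply H].
  - intros x Hx HQ. apply (consecutive_gap0 _ _ H x Hx). apply HPQ; [lra | exact HQ].
  - intros n x Hx HQ. apply (consecutive_gap _ _ H n x Hx). apply HPQ; [ | exact HQ].
    generalize (consecutive_positive _ _ n H). lra.
Qed.

(** Each interval (z'(n), z'(n+1)] contains a zero of the lower order. Since z(n) <= z'(n), that
    zero lies beyond z(n), hence z(n+1) does not exceed it. *)
Lemma zeros_below (nu nu' : R) (z z' : nat -> R) : 0 <= nu < nu' ->
  consecutive (fun x => cyl nu x = 0) z -> consecutive (fun x => cyl nu' x = 0) z' ->
  forall n, z n <= z' n.
Proof.
  intros Hnu Hz Hz'. induction n as [|n IH].
  - destruct (sturm_comparison nu nu' 0 (z' O)) as [c [Hc Hc0]]; trivial.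
    + split; [lra | apply Hz'].
    + now left.
    + apply (consecutive_in _ _ Hz').
    + intros x Hx. now apply (consecutive_gap0 _ _ Hz').
    + apply Rnot_lt_le. intros Hlt. apply (consecutive_gap0 _ _ Hz c); trivial. lra.
  - assert (Hp := consecutive_positive _ _ n Hz').
    destruct (sturm_comparison nu nu' (z' n) (z' (S n))) as [c [Hc Hc0]]; trivial.
    + split; [lra | apply Hz'].
    + right. apply (consecutive_in _ _ Hz').
    + apply (consecutive_in _ _ Hz').
    + intros x Hx. now apply (consecutive_gap _ _ Hz' n).
    + apply Rnot_lt_le. intros Hlt. apply (consecutive_gap _ _ Hz n c); trivial. lra.
Qed.

(** The next zero is the supremum of the lengths free of zeros. The set is nonempty because zeros do
    not accumulate at [c]: by the series at 0, by simplicity at a zero, by continuity elsewhere. *)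
Lemma next_zero (nu c d : R) : 0 <= nu -> 0 <= c < d -> cyl nu d = 0 ->
  exists x, c < x <= d /\ cyl nu x = 0 /\ forall t, c < t < x -> cyl nu t <> 0.
Proof.
  intros Hnu Hcd Hd.
  assert (Hgap : exists e, c < e /\ forall t, c < t < e -> cyl nu t <> 0).
  { destruct (Req_dec c 0) as [->|Hc0].
    - destruct (cyl_pos_near_0 nu Hnu) as [e [He H]]. exists e. split; trivial.
      intros t Ht. specialize (H t Ht). lra.
    - destruct (Req_dec (cyl nu c) 0) as [E|E].
      + assert (H1 := cyl1_neq_0 nu c Hnu ltac:(lra) E).
        destruct (continuity_pt_pos (fun x => cyl1 nu c * cyl1 nu x) c) as [e [He H]].
        { apply (continuity_pt_scal (cyl1 nu) (cyl1 nu c)). apply continuity_cyl1; lra. }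
        { nra. }
        exists (c + e). split; [lra | ]. intros t Ht Et.
        destruct (MVT_interval (cyl nu) (fun x => cyl1 nu x / x) c t) as [w [Hw Hw']]; [lra | | ].
        { intros x Hx. apply cyl_system; lra. }
        rewrite E, Et in Hw'. specialize (H w).
        rewrite Rabs_pos_eq in H by lra. specialize (H ltac:(lra)).
        assert (cyl1 nu w / w = 0).
        { apply Rmult_eq_reg_r with (t - c); lra. }
        assert (cyl1 nu w = 0).
        { replace (cyl1 nu w) with (cyl1 nu w / w * w) by (field; lra). rewrite H0. ring. }
        rewrite H2 in H. lra.
      + destruct (continuity_pt_pos (fun x => cyl nu c * cyl nu x) c) as [e [He H]].
        { apply (continuity_pt_scal (cyl nu) (cyl nu c)). apply continuity_cyl; lra. }
        { nra. }
        exists (c + e). split; [lra | ]. intros t Ht Et.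
        specialize (H t). rewrite Rabs_pos_eq, Et in H by lra. specialize (H ltac:(lra)). lra. }
  destruct Hgap as [e [Hce He]].
  destruct (completeness (fun m => c < m <= d /\ forall t, c < t < m -> cyl nu t <> 0))
    as [s [Hub Hlub]].
  - exists d. intros m Hm. lra.
  - exists (Rmin e d). split.
    + split; [apply Rmin_glb_lt; lra | apply Rmin_r].
    + intros t Ht. apply He. generalize (Rmin_l e d). lra.
  - assert (Hs1 : Rmin e d <= s).
    { apply Hub. split.
      + split; [apply Rmin_glb_lt; lra | apply Rmin_r].
      + intros t Ht. apply He. generalize (Rmin_l e d). lra. }
    assert (Hcs : c < s).
    { apply Rlt_le_trans with (2 := Hs1). apply Rmin_glb_lt; lra. }
    assert (Hsd : s <= d) by (apply Hlub; intros m Hm; lra).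
    assert (Hfree : forall t, c < t < s -> cyl nu t <> 0).
    { intros t Ht Et. assert (s <= t); [ | lra]. apply Hlub. intros m [Hm Hm'].
      apply Rnot_lt_le. intros Hlt. apply (Hm' t); trivial. lra. }
    exists s. split; [lra | ]. split; [ | exact Hfree].
    apply Classical_Prop.NNPP. intros Hn.
    assert (s <> d) by (intros ->; now apply Hn).
    destruct (continuity_pt_pos (fun x => cyl nu s * cyl nu x) s) as [r [Hr H']].
    { apply (continuity_pt_scal (cyl nu) (cyl nu s)). apply continuity_cyl; lra. }
    { nra. }
    assert (Hm : 0 < Rmin r (d - s)) by (apply Rmin_pos; lra).
    assert (Hm1 := Rmin_l r (d - s)). assert (Hm2 := Rmin_r r (d - s)).
    set (w := Rmin r (d - s)) in *.
    assert (s + w <= s); [ | lra]. apply Hub. split; [lra | ].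
    intros t Ht Et. destruct (Rlt_dec t s) as [Hts|Hts].
    + apply (Hfree t); trivial. lra.
    + specialize (H' t). rewrite Rabs_pos_eq, Et in H' by lra. specialize (H' ltac:(lra)). lra.
Qed.

Lemma consecutive_zeros_exist (nu nu' : R) (z' : nat -> R) : 0 <= nu < nu' ->
  enumerates (fun x => cyl nu' x = 0) z' ->
  exists z, consecutive (fun x => cyl nu x = 0) z.
Proof.
  intros Hnu [Hz' Hu].
  (* The condition on [c] sits inside the existential so that choice yields a total successor
     function; its value at negative [c] is arbitrary. *)
  assert (Hnext : forall c, exists x, 0 <= c ->
    c < x /\ cyl nu x = 0 /\ forall t, c < t < x -> cyl nu t <> 0).
  { intros c. destruct (Rle_dec 0 c) as [Hc|Hc]; [ | now exists 0; intros].
    (* Unboundedness of the zeros of the higher order provides a gap beyond [c], and Sturm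
       comparison puts a zero of order [nu] in it. *)
    destruct (Hu c) as [n Hn].
    assert (Hp := consecutive_positive _ _ n Hz').
    destruct (sturm_comparison nu nu' (z' n) (z' (S n))) as [d [Hd Hd0]]; trivial.
    - split; [lra | apply Hz'].
    - right. apply (consecutive_in _ _ Hz').
    - apply (consecutive_in _ _ Hz').
    - intros x Hx. now apply (consecutive_gap _ _ Hz' n).
    - destruct (next_zero nu c d) as [x Hx]; trivial; try lra.
      exists x. intros _. intuition. }
  apply functional_choice in Hnext. destruct Hnext as [F HF].
  set (z := fix z n := match n with O => F 0 | S n' => F (z n') end).
  assert (Hpos : forall n, 0 < z n).
  { induction n as [|n IH]; simpl.
    - apply HF. lra.
    - apply Rlt_trans with (1 := IH). apply HF. lra. }
  exists z. split.
  - apply Hpos.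
  - intros n. simpl. apply HF. apply Rlt_le, Hpos.
  - intros [|n]; simpl; apply HF; [lra | apply Rlt_le, Hpos].
  - intros x Hx. apply (HF 0); [lra | exact Hx].
  - intros n x Hx. apply (HF (z n)); [apply Rlt_le, Hpos | exact Hx].
Qed.

(** * Interlacing of critical points and zeros *)

Definition critical (nu delta x : R) : Prop := cyl1 nu x = delta * cyl nu x.

Lemma continuity_critical (nu delta x : R) : 0 <= nu -> 0 < x ->
  continuity_pt (fun x => cyl1 nu x - delta * cyl nu x) x.
Proof.
  intros Hnu Hx. apply continuity_pt_minus; [now apply continuity_cyl1 | ].
  apply (continuity_pt_scal (cyl nu) delta). now apply continuity_cyl.
Qed.

Lemma critical_unique (nu delta a b x x' : R) : 0 <= nu -> 0 <= a ->
  (forall t, a < t < b -> cyl nu t <> 0) -> a < x < b -> a < x' < b ->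
  critical nu delta x -> critical nu delta x' -> x = x'.
Proof.
  intros Hnu Ha Hn.
  assert (Hlt : forall x x', a < x -> x < x' -> x' < b ->
            critical nu delta x -> critical nu delta x' -> False).
  { clear x x'. intros x x' H1 H2 H3 Hx Hx'.
    assert (H := log_derivative_decreasing nu x x' Hnu ltac:(lra)).
    unfold critical in Hx, Hx'. rewrite Hx, Hx' in H.
    assert (cyl nu x <> 0) by (apply Hn; lra).
    assert (cyl nu x' <> 0) by (apply Hn; lra).
    replace (delta * cyl nu x / cyl nu x) with delta in H by (field; trivial).
    replace (delta * cyl nu x' / cyl nu x') with delta in H by (field; trivial).
    apply (Rlt_irrefl delta). apply H. intros t Ht. apply Hn. lra. }
  intros Hx Hx' Cx Cx'. destruct (Rtotal_order x x') as [H|[H|H]]; trivial; exfalso.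
  - now apply (Hlt x x').
  - now apply (Hlt x' x).
Qed.

(** The value at [m] records the sign on the whole interval. The function moves towards 0 as it
    approaches [b], and simplicity of the zero makes the inequality strict. *)
Lemma cyl1_sign_right_end (nu a b m : R) : 0 <= nu -> 0 <= a -> a < m < b ->
  (forall t, a < t < b -> cyl nu t <> 0) -> cyl nu b = 0 -> cyl nu m * cyl1 nu b < 0.
Proof.
  intros Hnu Ha Hm Hn Hb.
  assert (Hs : forall x, a < x < b -> 0 < cyl nu m * cyl nu x).
  { apply constant_sign_witness; trivial.
    - intros; lra.
    - intros x Hx. apply continuity_cyl; lra. }
  destruct (bessel_system_scal (cyl nu m) _ _ _ (cyl_system nu Hnu) b ltac:(lra)) as [H _].
  assert (Hl : cyl nu m * cyl1 nu b / b <= 0).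
  { apply (derive_nonpos_of_pos_left (fun x => cyl nu m * cyl nu x) a b); trivial; try lra.
    rewrite Hb; ring. }
  assert (cyl1 nu b <> 0) by (apply cyl1_neq_0; lra).
  assert (cyl nu m <> 0) by (apply Hn; lra).
  assert (cyl nu m * cyl1 nu b <> 0) by now apply Rmult_integral_contrapositive_currified.
  assert (cyl nu m * cyl1 nu b <= 0); [ | lra].
  replace (cyl nu m * cyl1 nu b) with (cyl nu m * cyl1 nu b / b * b) by (field; lra). nra.
Qed.

Lemma cyl1_sign_left_end (nu a b m : R) : 0 <= nu -> 0 < a -> a < m < b ->
  (forall t, a < t < b -> cyl nu t <> 0) -> cyl nu a = 0 -> 0 < cyl nu m * cyl1 nu a.
Proof.
  intros Hnu Ha Hm Hn Hb.
  assert (Hs : forall x, a < x < b -> 0 < cyl nu m * cyl nu x).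
  { apply constant_sign_witness; trivial.
    - intros; lra.
    - intros x Hx. apply continuity_cyl; lra. }
  destruct (bessel_system_scal (cyl nu m) _ _ _ (cyl_system nu Hnu) a ltac:(lra)) as [H _].
  assert (Hl : 0 <= cyl nu m * cyl1 nu a / a).
  { apply (derive_nonneg_of_pos_right (fun x => cyl nu m * cyl nu x) a b); trivial; try lra.
    rewrite Hb; ring. }
  assert (cyl1 nu a <> 0) by (apply cyl1_neq_0; lra).
  assert (cyl nu m <> 0) by (apply Hn; lra).
  assert (cyl nu m * cyl1 nu a <> 0) by now apply Rmult_integral_contrapositive_currified.
  assert (0 <= cyl nu m * cyl1 nu a); [ | lra].
  replace (cyl nu m * cyl1 nu a) with (cyl nu m * cyl1 nu a / a * a) by (field; lra). nra.
Qed.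

(** At the two zeros [cyl1 - delta * cyl] reduces to [cyl1], which has opposite signs there. *)
Lemma critical_between_zeros (nu delta a b : R) : 0 <= nu -> 0 < a < b ->
  (forall t, a < t < b -> cyl nu t <> 0) -> cyl nu a = 0 -> cyl nu b = 0 ->
  exists c, a < c < b /\ critical nu delta c.
Proof.
  intros Hnu Hab Hn Ha Hb.
  assert (H1 := cyl1_sign_left_end nu a b ((a + b) / 2) Hnu ltac:(lra) ltac:(lra) Hn Ha).
  assert (H2 := cyl1_sign_right_end nu a b ((a + b) / 2) Hnu ltac:(lra) ltac:(lra) Hn Hb).
  destruct (IVT_opposite_signs (fun x => cyl1 nu x - delta * cyl nu x) a b) as [c [Hc Hc0]].
  - lra.
  - intros x Hx. apply continuity_critical; lra.
  - rewrite Ha, Hb. set (m := cyl nu ((a + b) / 2)) in *.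
    destruct (Rle_dec m 0); nra.
  - exists c. split; trivial. unfold critical. lra.
Qed.

Lemma critical_before_zero (nu delta b : R) : 0 <= nu -> delta < nu -> 0 < b ->
  (forall t, 0 < t < b -> cyl nu t <> 0) -> cyl nu b = 0 ->
  exists c, 0 < c < b /\ critical nu delta c.
Proof.
  intros Hnu Hd Hb0 Hn Hb.
  destruct (cyl_pos_near_0 nu Hnu) as [e1 [He1 H1]].
  (* This is [cyl1 - delta * cyl] divided by x^nu. Its value at 0 is nu - delta, which is where
     [delta < nu] enters. *)
  destruct (pos_near_0 (fun x => (nu - delta) * phi nu (x ^ 2)
              - x ^ 2 / (2 * (nu + 1)) * phi (nu + 1) (x ^ 2))) as [e2 [He2 H2]].
  { ex_derive_phi. }
  { rewrite pow_0_2, !phi_0. lra. }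
  set (a := Rmin b (Rmin e1 e2) / 2).
  assert (Ha : 0 < a /\ a < b /\ a < e1 /\ a < e2).
  { unfold a. assert (G1 := Rmin_l b (Rmin e1 e2)). assert (G2 := Rmin_r b (Rmin e1 e2)).
    assert (G3 := Rmin_l e1 e2). assert (G4 := Rmin_r e1 e2).
    assert (0 < Rmin b (Rmin e1 e2)) by (repeat apply Rmin_pos; lra). lra. }
  clearbody a.
  assert (Hca := H1 a ltac:(lra)). assert (Hka := H2 a ltac:(lra)).
  assert (Hcb := cyl1_sign_right_end nu 0 b a Hnu ltac:(lra) ltac:(lra) Hn Hb).
  assert (Hga : 0 < cyl1 nu a - delta * cyl nu a).
  { replace (_ - _) with (Rpower a nu * ((nu - delta) * phi nu (a ^ 2)
              - a ^ 2 / (2 * (nu + 1)) * phi (nu + 1) (a ^ 2))).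
    - apply Rmult_lt_0_compat; [apply exp_pos | exact Hka].
    - unfold cyl, cyl1. ring. }
  destruct (IVT_opposite_signs (fun x => cyl1 nu x - delta * cyl nu x) a b) as [c [Hc Hc0]].
  - lra.
  - intros x Hx. apply continuity_critical; lra.
  - rewrite Hb. assert (cyl1 nu b < 0) by nra. nra.
  - exists c. split; [lra | ]. unfold critical. lra.
Qed.

(** The ratio [cyl1 / cyl] decreases, so if it equalled nu at [x] it would exceed nu at smaller
    points. But x J' - nu J = - x J_(nu+1) makes it less than nu near 0. *)
Lemma no_critical_before_zero (nu b x : R) : 0 <= nu ->
  (forall t, 0 < t < b -> cyl nu t <> 0) -> 0 < x < b -> ~ critical nu nu x.
Proof.
  intros Hnu Hn Hx Hc.
  destruct (cyl_pos_near_0 nu Hnu) as [e1 [He1 H1]].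
  destruct (cyl_pos_near_0 (nu + 1)) as [e2 [He2 H2]]; [lra | ].
  set (a := Rmin x (Rmin e1 e2) / 2).
  assert (Ha : 0 < a /\ a < x /\ a < e1 /\ a < e2).
  { unfold a. assert (G1 := Rmin_l x (Rmin e1 e2)). assert (G2 := Rmin_r x (Rmin e1 e2)).
    assert (G3 := Rmin_l e1 e2). assert (G4 := Rmin_r e1 e2).
    assert (0 < Rmin x (Rmin e1 e2)) by (repeat apply Rmin_pos; lra). lra. }
  clearbody a.
  assert (Hca := H1 a ltac:(lra)). assert (Hka := H2 a ltac:(lra)).
  assert (H := log_derivative_decreasing nu a x Hnu ltac:(lra)).
  unfold critical in Hc. rewrite Hc in H.
  assert (cyl nu x <> 0) by (apply Hn; lra).
  replace (nu * cyl nu x / cyl nu x) with nu in H by (field; trivial).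
  assert (nu < cyl1 nu a / cyl nu a).
  { apply H. intros t Ht. apply Hn. lra. }
  assert (Hlt : nu * cyl nu a < cyl1 nu a).
  { apply Rmult_lt_reg_r with (/ cyl nu a); [now apply Rinv_0_lt_compat | ].
    rewrite Rmult_assoc, Rinv_r by lra. unfold Rdiv in *; lra. }
  unfold cyl1, cyl in Hlt. unfold cyl in Hka.
  assert (0 < Rpower a nu) by apply exp_pos.
  assert (0 < Rpower a (nu + 1)) by apply exp_pos.
  assert (Hp : 0 < phi (nu + 1) (a ^ 2)) by (apply Rnot_le_lt; nra).
  assert (0 < a ^ 2 / (2 * (nu + 1)) * phi (nu + 1) (a ^ 2)).
  { apply Rmult_lt_0_compat; trivial. apply Rdiv_lt_0_compat; [nra | lra]. }
  nra.
Qed.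

(** One indexing serves both cases: [c (S k)] always lies between [z k] and [z (S k)], so the
    location estimate is the same. For [delta = nu] the term [c 0] is a meaningless choice and the
    enumeration starts at [c 1], in agreement with [first_index]. *)
Lemma critical_zeros_interlace (nu delta : R) (z : nat -> R) :
  0 <= nu -> delta <= nu -> enumerates (fun x => cyl nu x = 0) z ->
  exists c : nat -> R, (forall k, z k < c (S k) < z (S k)) /\
    (delta < nu -> enumerates (critical nu delta) c) /\
    (delta = nu -> enumerates (critical nu delta) (fun n => c (S n))).
Proof.
  intros Hnu Hd Hz. assert (Hz' := Hz). destruct Hz' as [Hc Hu].
  assert (Hpos := fun n => consecutive_positive _ _ n Hc).
  assert (Hnz : forall k, ~ critical nu delta (z k)).
  { intros k Hk. unfold critical in Hk. rewrite (consecutive_in _ _ Hc k), Rmult_0_r in Hk.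
    now apply (cyl1_neq_0 nu (z k)); [ | | apply (consecutive_in _ _ Hc) | ]. }
  assert (Hex : forall k, exists x, match k with
     | O => delta < nu -> 0 < x < z O /\ critical nu delta x
     | S k => z k < x < z (S k) /\ critical nu delta x end).
  { intros [|k].
    - destruct (Rlt_dec delta nu) as [Hlt|Hn].
      + destruct (critical_before_zero nu delta (z O)) as [x Hx]; trivial.
        * apply (consecutive_gap0 _ _ Hc).
        * apply (consecutive_in _ _ Hc).
        * now exists x.
      + exists 0. intros; lra.
    - apply critical_between_zeros; trivial.
      + split; [apply Hpos | apply Hc].
      + apply (consecutive_gap _ _ Hc k).
      + apply (consecutive_in _ _ Hc).
      + apply (consecutive_in _ _ Hc). }
  apply functional_choice in Hex. destruct Hex as [c HF].
  assert (HS : forall k, z k < c (S k) < z (S k)) by (intros k; apply (HF (S k))).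
  assert (HC : forall k, critical nu delta (c (S k))) by (intros k; apply (HF (S k))).
  assert (Hsame : forall k x, z k < x < z (S k) -> critical nu delta x -> x = c (S k)).
  { intros k x Hx Cx. apply (critical_unique nu delta (z k) (z (S k))); trivial.
    - generalize (Hpos k); lra.
    - apply (consecutive_gap _ _ Hc k). }
  assert (Hgap : forall k x, c (S k) < x < c (S (S k)) -> ~ critical nu delta x).
  { intros k x Hx Cx. generalize (HS k) (HS (S k)); intros G1 G2.
    destruct (Rtotal_order x (z (S k))) as [H|[H|H]].
    - assert (x = c (S k)) by (apply Hsame; trivial; lra). lra.
    - subst x. now apply (Hnz (S k)).
    - assert (x = c (S (S k))) by (apply Hsame; trivial; lra). lra. }
  exists c. split; [exact HS | ]. split.
  - intros Hlt. destruct (HF O Hlt) as [H0 C0].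
    assert (Hsame0 : forall x, 0 < x < z O -> critical nu delta x -> x = c O).
    { intros x Hx Cx. apply (critical_unique nu delta 0 (z O)); trivial; try lra.
      apply (consecutive_gap0 _ _ Hc). }
    split; [split | ].
    + apply H0.
    + intros [|n].
      * generalize (HS O). lra.
      * generalize (HS n) (HS (S n)). lra.
    + intros [|n]; trivial.
    + intros x Hx Cx. assert (x = c O) by (apply Hsame0; trivial; lra). lra.
    + intros [|n] x Hx Cx.
      * generalize (HS O); intros G. destruct (Rtotal_order x (z O)) as [H|[H|H]].
        -- assert (x = c O) by (apply Hsame0; trivial; lra). lra.
        -- subst x. now apply (Hnz O).
        -- assert (x = c 1%nat) by (apply Hsame; trivial; lra). lra.
      * now apply (Hgap n x).
    + intros M. destruct (Hu M) as [n Hn]. exists (S n). generalize (HS n). lra.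
  - intros E. split; [split | ].
    + generalize (HS O) (Hpos O). lra.
    + intros n. generalize (HS n) (HS (S n)). lra.
    + exact HC.
    + intros x Hx Cx. generalize (HS O); intros G.
      destruct (Rtotal_order x (z O)) as [H|[H|H]].
      * rewrite E in Cx. apply (no_critical_before_zero nu (z O) x); trivial; [ | lra].
        apply (consecutive_gap0 _ _ Hc).
      * subst x. now apply (Hnz O).
      * assert (x = c 1%nat) by (apply Hsame; trivial; lra). lra.
    + exact Hgap.
    + intros M. destruct (Hu M) as [n Hn]. exists n. generalize (HS n). lra.
Qed.

(** From x J_nu' - nu J_nu = - x J_(nu+1). *)
Lemma critical_self (nu x : R) : 0 <= nu -> 0 < x ->
  critical nu nu x <-> cyl (nu + 1) x = 0.
Proof.
  intros Hnu Hx. unfold critical, cyl, cyl1.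
  assert (H1 : 0 < Rpower x nu) by apply exp_pos.
  assert (H2 : 0 < Rpower x (nu + 1)) by apply exp_pos.
  assert (H3 : 0 < x ^ 2 / (2 * (nu + 1))) by (apply Rdiv_lt_0_compat; nra).
  split; intros H.
  - assert (H' : Rpower x nu * (x ^ 2 / (2 * (nu + 1)) * phi (nu + 1) (x ^ 2)) = 0) by lra.
    apply Rmult_integral in H'. destruct H' as [H'|H']; [lra | ].
    apply Rmult_integral in H'. destruct H' as [H'|H']; [lra | ].
    rewrite H'. ring.
  - apply Rmult_integral in H. destruct H as [H|H]; [lra | ].
    rewrite H. ring.
Qed.

(** From x J_(nu+1)' + (nu + 1) J_(nu+1) = x J_nu, which here is the contiguous relation. *)
Lemma critical_opp (nu x : R) : 0 <= nu -> 0 < x ->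
  critical (nu + 1) (- (nu + 1)) x <-> cyl nu x = 0.
Proof.
  intros Hnu Hx. unfold critical, cyl, cyl1.
  assert (H1 : 0 < Rpower x nu) by apply exp_pos.
  assert (H2 : 0 < Rpower x (nu + 1)) by apply exp_pos.
  assert (H3 := phi_contiguous nu (x ^ 2) Hnu).
  replace (nu + 1 + 1) with (nu + 2) by ring.
  set (f2 := phi (nu + 2) (x ^ 2)) in *. set (f1 := phi (nu + 1) (x ^ 2)) in *.
  set (f0 := phi nu (x ^ 2)) in *.
  assert (H4 : Rpower x (nu + 1) * ((nu + 1) * f1 - x ^ 2 / (2 * (nu + 2)) * f2)
     - - (nu + 1) * (Rpower x (nu + 1) * f1) = Rpower x (nu + 1) * (2 * (nu + 1) * f0)).
  { rewrite Rmult_assoc. rewrite <- H3. field. lra. }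
  split; intros H.
  - rewrite H, Rminus_diag in H4. symmetry in H4.
    apply Rmult_integral in H4. destruct H4 as [H4|H4]; [lra | ].
    assert (f0 = 0) by nra. rewrite H0. ring.
  - apply Rmult_integral in H. destruct H as [H|H]; [lra | ].
    rewrite H in H4. lra.
Qed.

(** The infimum in [next_crit] is attained: the next term of [s] belongs to the set, and the gap
    condition makes it the least element. *)
Lemma crit_enumerated (nu delta : R) (s : nat -> R) :
  consecutive (fun x => is_derive (besselj nu delta) x 0) s ->
  forall n, crit nu delta n = s n.
Proof.
  intros Hs.
  assert (Hnext : forall c x, c < x -> is_derive (besselj nu delta) x 0 ->
    (forall t, c < t < x -> ~ is_derive (besselj nu delta) t 0) -> next_crit nu delta c = x).
  { intros c x Hx Cx Hgap. unfold next_crit. rewrite (is_glb_Rbar_unique _ (Finite x)); trivial.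
    split.
    - intros t [Ht Ct]. simpl. apply Rnot_lt_le. intros Hlt. now apply (Hgap t).
    - intros b Hb. now apply (Hb x). }
  induction n as [|n IH]; simpl.
  - apply Hnext; [apply Hs | apply (consecutive_in _ _ Hs) | apply (consecutive_gap0 _ _ Hs)].
  - rewrite IH. apply Hnext; [apply Hs | apply (consecutive_in _ _ Hs) | ].
    apply (consecutive_gap _ _ Hs).
Qed.

Lemma is_derive_besselj_0 (nu delta x : R) : 0 <= nu -> 0 < x ->
  is_derive (besselj nu delta) x 0 <-> critical nu delta x.
Proof.
  intros Hnu Hx.
  set (K := Rpower (/ 2) nu / Gamma (nu + 1)).
  assert (HK : 0 < K).
  { apply Rdiv_lt_0_compat; [apply exp_pos | apply Gamma_pos; lra]. }
  assert (Hd : is_derive (besselj nu delta) x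
     (K * Rpower x (- delta - 1) * (cyl1 nu x - delta * cyl nu x))).
  (* The series formula for [BesselJ] is available for positive arguments only, hence equality near
     x instead of everywhere. *)
  { apply (is_derive_ext_loc (fun x => K * (Rpower x (- delta) * cyl nu x))).
    - exists (mkposreal x Hx). intros t Ht.
      unfold ball in Ht; simpl in Ht; unfold AbsRing_ball, abs, minus, plus, opp in Ht; simpl in Ht.
      apply Rabs_def2 in Ht. unfold besselj. rewrite BesselJ_phi by lra. unfold cyl, K, Rdiv.
      rewrite <- Rpower_mult_distr by lra.
      ring_R.
    - destruct (cyl_system nu Hnu x Hx) as [H0 _].
      assert (HR : Rpower x (- delta) = Rpower x (- delta - 1) * x).
      { rewrite <- (Rpower_1 x Hx) at 3. rewrite <- Rpower_plus. f_equal. ring. }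
      eapply is_derive_value.
      + exact (is_derive_scal _ x K _
                 (is_derive_Rmult _ _ _ _ _ (is_derive_Rpower_l (- delta) x Hx) H0)).
      + cbv beta. rewrite HR. field. lra. }
  assert (Hpow : 0 < Rpower x (- delta - 1)) by apply exp_pos.
  unfold critical. split; intros H.
  - assert (E : K * Rpower x (- delta - 1) * (cyl1 nu x - delta * cyl nu x) = 0).
    { rewrite <- (is_derive_unique _ _ _ Hd). now apply is_derive_unique. }
    assert (0 < K * Rpower x (- delta - 1)) by now apply Rmult_lt_0_compat.
    apply Rmult_integral in E. destruct E as [E|E]; lra.
  - apply (is_derive_value _ _ _ _ Hd). rewrite H. ring.
Qed.

(** * The phase at infinity *)

Lemma ex_series_Rabs_le (a b : nat -> R) :
  (forall n, Rabs (a n) <= b n) -> ex_series b -> ex_series a.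
Proof. intros H. now apply (ex_series_le a b). Qed.

(** Termwise differentiation by summing the first-order Taylor remainders, each at most K(m) h^2;
    the error of the difference quotient is then at most |h| times the sum of [K]. *)
Lemma is_derive_Series (g dg : nat -> R -> R) (K : nat -> R) (t : R) :
  (forall m h, Rabs (g m (t + h) - g m t - h * dg m t) <= K m * h ^ 2) ->
  ex_series K -> (forall x, ex_series (fun m => g m x)) -> ex_series (fun m => dg m t) ->
  is_derive (fun x => Series (fun m => g m x)) t (Series (fun m => dg m t)).
Proof.
  intros HK Hex Hg Hdg. apply is_derive_Reals.
  assert (HK0 : forall m, 0 <= K m).
  { intros m. specialize (HK m 1). generalize (Rabs_pos (g m (t + 1) - g m t - 1 * dg m t)). lra. }
  assert (HS : 0 <= Series K).
  { rewrite <- (Series_ext (fun m => Rabs (K m))) by (intros; now apply Rabs_pos_eq).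
    apply Rle_trans with (2 := Series_Rabs _ (ex_series_ext _ _
      (fun m => eq_sym (Rabs_pos_eq _ (HK0 m))) Hex)). apply Rabs_pos. }
  intros eps He.
  assert (Hd : 0 < eps / (Series K + 1)) by (apply Rdiv_lt_0_compat; lra).
  exists (mkposreal _ Hd). simpl. intros h Hh Hlt.
  assert (HD : Rabs (Series (fun m => g m (t + h)) - Series (fun m => g m t)
                - h * Series (fun m => dg m t)) <= Series K * h ^ 2).
  { rewrite <- Series_scal_l, <- !Series_minus; trivial.
    2: now apply (ex_series_minus (V := R_NormedModule)).
    2: now apply (ex_series_scal (V := R_NormedModule)).
    assert (Hb : ex_series (fun m => K m * h ^ 2)).
    { apply (ex_series_ext (fun m => h ^ 2 * K m)); [intros; apply Rmult_comm | ].
      now apply (ex_series_scal (V := R_NormedModule)). }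
    rewrite <- Series_scal_r.
    apply Rle_trans with (Series (fun m => Rabs (g m (t + h) - g m t - h * dg m t))).
    - apply Series_Rabs. apply (ex_series_Rabs_le _ (fun m => K m * h ^ 2)); trivial.
      intros m. rewrite Rabs_Rabsolu. apply HK.
    - apply Series_le; trivial. intros m. split; [apply Rabs_pos | apply HK]. }
  replace (_ - _) with ((Series (fun m => g m (t + h)) - Series (fun m => g m t)
                - h * Series (fun m => dg m t)) / h) by (field; trivial).
  unfold Rdiv at 1. rewrite Rabs_mult, Rabs_inv.
  assert (Hah : 0 < Rabs h) by now apply Rabs_pos_lt.
  apply Rmult_lt_reg_r with (Rabs h); trivial.
  rewrite Rmult_assoc, Rinv_l, Rmult_1_r by lra.
  apply Rle_lt_trans with (1 := HD). rewrite <- (pow2_abs h).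
  assert (Hm : Rabs h * (Series K + 1) < eps).
  { apply Rmult_lt_reg_r with (/ (Series K + 1)); [apply Rinv_0_lt_compat; lra | ].
    rewrite Rmult_assoc, Rinv_r by lra. unfold Rdiv in Hlt. lra. }
  nra.
Qed.

(** * Trigonometric series: power series restricted to a circle *)

Lemma Rabs_sin_diff (a b : R) : Rabs (sin b - sin a) <= Rabs (b - a).
Proof.
  destruct (MVT_gen sin a b cos) as [c [_ ->]].
  - intros x _. auto_derive; [exact I | ring].
  - intros x _. apply continuity_sin.
  - rewrite Rabs_mult. assert (Rabs (cos c) <= 1) by (apply Rabs_le, COS_bound).
    generalize (Rabs_pos (b - a)). nra.
Qed.

Lemma Rabs_cos_diff (a b : R) : Rabs (cos b - cos a) <= Rabs (b - a).
Proof.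
  rewrite <- !sin_shift. eapply Rle_trans; [apply Rabs_sin_diff | ].
  rewrite Rabs_minus_sym. right. f_equal. ring.
Qed.

(** What sine and cosine share, so that real and imaginary parts are handled by the same lemmas. *)
Definition lipschitz_C1 (u du : R -> R) : Prop :=
  (forall x, is_derive u x (du x)) /\ (forall x, Rabs (u x) <= 1) /\
  (forall x, Rabs (du x) <= 1) /\ (forall a b, Rabs (du b - du a) <= Rabs (b - a)).

Lemma lipschitz_C1_cos : lipschitz_C1 cos (fun x => - sin x).
Proof.
  split; [ | split; [ | split]].
  - intros x. auto_derive; [exact I | ring].
  - intros x. apply Rabs_le, COS_bound.
  - intros x. rewrite Rabs_Ropp. apply Rabs_le, SIN_bound.
  - intros a b. replace (- sin b - - sin a) with (- (sin b - sin a)) by ring.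
    rewrite Rabs_Ropp. apply Rabs_sin_diff.
Qed.

Lemma lipschitz_C1_sin : lipschitz_C1 sin cos.
Proof.
  split; [ | split; [ | split]].
  - intros x. auto_derive; [exact I | ring].
  - intros x. apply Rabs_le, SIN_bound.
  - intros x. apply Rabs_le, COS_bound.
  - apply Rabs_cos_diff.
Qed.

Lemma taylor_lipschitz_C1 (u du : R -> R) (a c : R) : lipschitz_C1 u du ->
  Rabs (u (a + c) - u a - c * du a) <= c ^ 2.
Proof.
  intros (Hd & _ & _ & HL). destruct (MVT_gen u a (a + c) du) as [w [Hw E]].
  - intros x _. apply Hd.
  - intros x _. exact (is_derive_continuity_pt _ _ _ (Hd x)).
  - rewrite E. replace (du w * (a + c - a) - c * du a) with (c * (du w - du a)) by ring.
    rewrite Rabs_mult, <- (pow2_abs c).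
    assert (Rabs (w - a) <= Rabs c).
    { revert Hw. unfold Rmin, Rmax. destruct (Rle_dec a (a + c)); intros Hw.
      - rewrite !Rabs_pos_eq; lra.
      - rewrite !Rabs_left1; lra. }
    generalize (HL a w) (Rabs_pos c). nra.
Qed.

Definition trig_series (u : R -> R) (b : nat -> R) (t : R) : R :=
  Series (fun m => b m * u (2 * INR m * t)).

Lemma double_le_pow2 (m : nat) : 2 * INR m <= 2 ^ m.
Proof.
  induction m as [|[|m] IH]; [simpl; lra | simpl; lra | ].
  rewrite S_INR. rewrite <- tech_pow_Rmult.
  assert (2 <= 2 ^ S m).
  { simpl. generalize (pow_R1_Rle 2 m ltac:(lra)). lra. }
  lra.
Qed.

(** The weights that appear after zero, one or two differentiations of u(2mt); a single summability
    condition with weight 4^m covers all three. *)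
Lemma weight_le_pow4 (m : nat) : 1 <= 4 ^ m /\ 2 * INR m <= 4 ^ m /\ (2 * INR m) ^ 2 <= 4 ^ m.
Proof.
  assert (H1 := pow_R1_Rle 2 m ltac:(lra)). assert (H2 := double_le_pow2 m).
  assert (H3 := pos_INR m).
  assert (E : 4 ^ m = (2 ^ m) ^ 2).
  { replace 4 with (2 ^ 2) by ring. rewrite <- !pow_mult. f_equal. lia. }
  rewrite E. repeat split; nra.
Qed.

Lemma ex_trig_series (u : R -> R) (b : nat -> R) (w : nat -> R) :
  (forall m, Rabs (w m) <= 4 ^ m) -> (forall x, Rabs (u x) <= 1) ->
  ex_series (fun m => Rabs (b m) * 4 ^ m) ->
  forall t, ex_series (fun m => w m * b m * u (2 * INR m * t)).
Proof.
  intros Hw Hu Hb t. refine (ex_series_Rabs_le _ _ _ Hb). intros m.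
  rewrite !Rabs_mult. specialize (Hw m). specialize (Hu (2 * INR m * t)).
  generalize (Rabs_pos (w m)) (Rabs_pos (b m)) (Rabs_pos (u (2 * INR m * t))). intros.
  apply Rle_trans with (Rabs (w m) * Rabs (b m)).
  - rewrite <- (Rmult_1_r (Rabs (w m) * Rabs (b m))) at 2.
    apply Rmult_le_compat_l; trivial. now apply Rmult_le_pos.
  - rewrite Rmult_comm. now apply Rmult_le_compat_l.
Qed.

Lemma is_derive_trig_series (u du : R -> R) (b : nat -> R) (t : R) : lipschitz_C1 u du ->
  ex_series (fun m => Rabs (b m) * 4 ^ m) ->
  is_derive (trig_series u b) t (trig_series du (fun m => 2 * INR m * b m) t).
Proof.
  intros Hu Hb. unfold trig_series.
  apply (is_derive_Series (fun m t => b m * u (2 * INR m * t))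
          (fun m t => 2 * INR m * b m * du (2 * INR m * t))
          (fun m => Rabs (b m) * (2 * INR m) ^ 2)).
  - intros m h.
    replace (b m * u (2 * INR m * (t + h)) - b m * u (2 * INR m * t)
      - h * (2 * INR m * b m * du (2 * INR m * t)))
    with (b m * (u (2 * INR m * t + 2 * INR m * h) - u (2 * INR m * t)
           - (2 * INR m * h) * du (2 * INR m * t))).
    2: { replace (2 * INR m * (t + h)) with (2 * INR m * t + 2 * INR m * h) by ring. ring. }
    rewrite Rabs_mult, (Rmult_assoc (Rabs (b m))).
    apply Rmult_le_compat_l; [apply Rabs_pos | ].
    rewrite <- Rpow_mult_distr. now apply taylor_lipschitz_C1.
  - refine (ex_series_Rabs_le _ _ _ Hb). intros m.
    rewrite Rabs_mult, Rabs_Rabsolu. apply Rmult_le_compat_l; [apply Rabs_pos | ].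
    rewrite Rabs_pos_eq by apply pow2_ge_0. apply weight_le_pow4.
  - intros x. apply (ex_series_ext (fun m => 1 * b m * u (2 * INR m * x))).
    { intros m. ring_R. }
    apply ex_trig_series; trivial; [ | apply Hu].
    intros m. rewrite Rabs_R1. apply weight_le_pow4.
  - apply (ex_trig_series du b (fun m => 2 * INR m)); trivial; [ | apply Hu].
    intros m. rewrite Rabs_pos_eq; [apply weight_le_pow4 | generalize (pos_INR m); lra].
Qed.

(** * The Bessel series on the circle of radius r *)

Definition arc_coef (nu r : R) (m : nat) : R := bcoef nu m * (r ^ 2) ^ m.

Lemma arc_coef_summable (nu r q : R) : 0 <= nu -> 0 <= q ->
  ex_series (fun m => Rabs (arc_coef nu r m) * q ^ m).
Proof.
  intros Hnu Hq.
  apply (ex_series_ext (fun m => Rabs (bcoef nu m * (q * r ^ 2) ^ m))).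
  - intros m. unfold arc_coef. rewrite Rpow_mult_distr, !Rabs_mult.
    rewrite (Rabs_pos_eq (q ^ m)) by now apply pow_le.
    ring_R.
  - apply CV_disk_inside. now rewrite CV_radius_bcoef.
Qed.

Lemma arc_coef1_summable (nu r : R) : 0 <= nu ->
  ex_series (fun m => Rabs (2 * INR m * arc_coef nu r m) * 4 ^ m).
Proof.
  (* Since 8^m = 2^m 4^m, the spare factor 2^m absorbs the weight 2m. *)
  intros Hnu. refine (ex_series_Rabs_le _ _ _ (arc_coef_summable nu r 8 Hnu ltac:(lra))).
  intros m. rewrite Rabs_mult, Rabs_Rabsolu, (Rabs_pos_eq (4 ^ m)) by (apply pow_le; lra).
  rewrite Rabs_mult, (Rabs_pos_eq (2 * INR m)) by (generalize (pos_INR m); lra).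
  assert (H := double_le_pow2 m).
  assert (E : 8 ^ m = 2 ^ m * 4 ^ m) by (rewrite <- Rpow_mult_distr; f_equal; ring).
  rewrite E. assert (0 < 4 ^ m) by (apply pow_lt; lra).
  generalize (Rabs_pos (arc_coef nu r m)). intros.
  rewrite (Rmult_comm (2 * INR m)), Rmult_assoc.
  apply Rmult_le_compat_l; trivial. apply Rmult_le_compat_r; lra.
Qed.

(** The differential equation (z d/dz)^2 f + 2 nu (z d/dz) f + z^2 f = 0 for f = z^(-nu) J_nu, on
    the circle. Each z d/dz contributes a weight 2m, and the shift by 2t is the argument of z^2. *)
Lemma arc_coef_recurrence (u : R -> R) (nu r t : R) : 0 <= nu ->
  (forall x, Rabs (u x) <= 1) ->
  trig_series u (fun m => 2 * INR m * (2 * INR m * arc_coef nu r m)) t =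
  - (2 * nu * trig_series u (fun m => 2 * INR m * arc_coef nu r m) t)
  - r ^ 2 * Series (fun m => arc_coef nu r m * u (2 * INR m * t + 2 * t)).
Proof.
  intros Hnu Hu. unfold trig_series.
  assert (Hex1 : ex_series (fun m => 2 * INR m * arc_coef nu r m * u (2 * INR m * t))).
  { apply (ex_trig_series u (arc_coef nu r) (fun m => 2 * INR m)); trivial.
    - intros m. rewrite Rabs_pos_eq; [apply weight_le_pow4 | generalize (pos_INR m); lra].
    - apply arc_coef_summable; lra. }
  assert (Hex2 : ex_series (fun m => 2 * INR m * (2 * INR m * arc_coef nu r m) * u (2 * INR m * t))).
  { apply (ex_trig_series u (fun m => 2 * INR m * arc_coef nu r m) (fun m => 2 * INR m)); trivial.
    - intros m. rewrite Rabs_pos_eq; [apply weight_le_pow4 | generalize (pos_INR m); lra].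
    - now apply arc_coef1_summable. }
  (* The weighted terms with m = 0 vanish; dropping them aligns the indices with those of the z^2 f
     series. *)
  rewrite (Series_incr_1 (fun m => 2 * INR m * arc_coef nu r m * u (2 * INR m * t))); trivial.
  rewrite (Series_incr_1 (fun m => 2 * INR m * (2 * INR m * arc_coef nu r m) * u (2 * INR m * t)));
    trivial.
  simpl (INR 0). rewrite Rmult_0_r, !Rmult_0_l, !Rplus_0_l.
  apply ex_series_incr_1 in Hex1. apply ex_series_incr_1 in Hex2.
  assert (Hex3 : ex_series (fun m => arc_coef nu r m * u (2 * INR m * t + 2 * t))).
  { refine (ex_series_Rabs_le _ _ _ (arc_coef_summable nu r 1 Hnu ltac:(lra))).
    intros m. rewrite pow1, Rabs_mult. apply Rmult_le_compat_l; [apply Rabs_pos | apply Hu]. }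
  rewrite <- !Series_scal_l, <- Series_opp.
  rewrite <- Series_minus.
  - apply Series_ext. intros m. rewrite S_INR.
    replace (2 * (INR m + 1) * t) with (2 * INR m * t + 2 * t) by ring.
    unfold arc_coef. rewrite bcoef_S. simpl pow. field.
    generalize (pos_INR m). lra.
  - apply (ex_series_opp (V := R_NormedModule)).
    now apply (ex_series_scal (V := R_NormedModule) (2 * nu)).
  - now apply (ex_series_scal (V := R_NormedModule) (r ^ 2)).
Qed.

Lemma trig_series_opp_sin (b : nat -> R) (t : R) :
  trig_series (fun x => - sin x) b t = - trig_series sin b t.
Proof.
  unfold trig_series. rewrite <- Series_opp. apply Series_ext. intros m. ring.
Qed.

Lemma ex_arc_series (u : R -> R) (nu r t : R) : 0 <= nu -> (forall x, Rabs (u x) <= 1) ->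
  ex_series (fun m => arc_coef nu r m * u (2 * INR m * t)).
Proof.
  intros Hnu Hu.
  refine (ex_series_Rabs_le _ _ _ (arc_coef_summable nu r 1 Hnu ltac:(lra))).
  intros m. rewrite pow1, Rabs_mult. apply Rmult_le_compat_l; [apply Rabs_pos | apply Hu].
Qed.

Lemma arc_shift_sin (nu r t : R) : 0 <= nu ->
  Series (fun m => arc_coef nu r m * sin (2 * INR m * t + 2 * t)) =
  cos (2 * t) * trig_series sin (arc_coef nu r) t + sin (2 * t) * trig_series cos (arc_coef nu r) t.
Proof.
  intros Hnu. unfold trig_series.
  assert (H1 := ex_arc_series sin nu r t Hnu (proj1 (proj2 lipschitz_C1_sin))).
  assert (H2 := ex_arc_series cos nu r t Hnu (proj1 (proj2 lipschitz_C1_cos))).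
  rewrite <- !Series_scal_l, <- Series_plus.
  - apply Series_ext. intros m. rewrite sin_plus. ring.
  - now apply (ex_series_scal (V := R_NormedModule) (cos (2 * t))).
  - now apply (ex_series_scal (V := R_NormedModule) (sin (2 * t))).
Qed.

Lemma arc_shift_cos (nu r t : R) : 0 <= nu ->
  Series (fun m => arc_coef nu r m * cos (2 * INR m * t + 2 * t)) =
  cos (2 * t) * trig_series cos (arc_coef nu r) t - sin (2 * t) * trig_series sin (arc_coef nu r) t.
Proof.
  intros Hnu. unfold trig_series.
  assert (H1 := ex_arc_series sin nu r t Hnu (proj1 (proj2 lipschitz_C1_sin))).
  assert (H2 := ex_arc_series cos nu r t Hnu (proj1 (proj2 lipschitz_C1_cos))).
  rewrite <- !Series_scal_l, <- Series_minus.
  - apply Series_ext. intros m. rewrite cos_plus. ring.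
  - now apply (ex_series_scal (V := R_NormedModule) (cos (2 * t))).
  - now apply (ex_series_scal (V := R_NormedModule) (sin (2 * t))).
Qed.

(** * Transport of the phase along the quarter circle *)

Lemma gronwall (S dS K k : R -> R) (a b : R) : a <= b ->
  (forall t, a <= t <= b -> is_derive S t (dS t)) ->
  (forall t, a <= t <= b -> is_derive K t (k t)) ->
  (forall t, a <= t <= b -> dS t <= k t * S t) ->
  S b <= S a * exp (K b - K a).
Proof.
  intros Hab HS HK Hle.
  assert (H : - (S a * exp (- K a)) <= - (S b * exp (- K b))).
  { apply (nondecreasing_of_derive (fun t => - (S t * exp (- K t)))
             (fun t => (k t * S t - dS t) * exp (- K t))); trivial.
    - intros t Ht.
      assert (HE : is_derive (fun t => exp (- K t)) t (- k t * exp (- K t))).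
      { apply (is_derive_comp exp (fun t => - K t)).
        - auto_derive; [exact I | ring].
        - exact (is_derive_opp K t _ (HK t Ht)). }
      eapply is_derive_value.
      + exact (is_derive_opp _ t _ (is_derive_Rmult _ _ _ _ _ (HS t Ht) HE)).
      + unfold opp; simpl. ring.
    - intros t Ht. apply Rmult_le_pos; [specialize (Hle t Ht); lra | apply Rlt_le, exp_pos]. }
  replace (exp (K b - K a)) with (exp (K b) * exp (- K a)) by (rewrite <- exp_plus; f_equal; ring).
  apply Rmult_le_reg_r with (exp (- K b)); [apply exp_pos | ].
  replace (S a * (exp (K b) * exp (- K a)) * exp (- K b))
    with (S a * exp (- K a) * (exp (K b) * exp (- K b))) by ring.
  rewrite <- exp_plus, Rplus_opp_r, exp_0. lra.
Qed.

(* The path runs along the arc [z = r exp(i t)], [0 <= t <= PI / 2].  With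
   [s = nu + 1/2], [h = exp(iz) z^(s-1) f] and [g = exp(iz) z^(s-1) (z f')] for
   [f = z^(-nu) J_nu], [A = g + (s - iz) h] and
   [B = g + (s + iz) h] satisfy [A' = i s (s-1) h] and
   [B' = -2 z B + i s (s-1) h]: the recessive part [B] is damped because
   [Re z >= 0], and the dominant part [A] moves by [O(1/r)] only. *)
Lemma arc_transport (nu s r : R) (h1 h2 g1 g2 : R -> R) :
  s = nu + 1 / 2 -> 1 <= r ->
  (forall t, is_derive h1 t (- (r * cos t) * h1 t + r * sin t * h2 t - (s - 1) * h2 t - g2 t)) ->
  (forall t, is_derive h2 t (- (r * cos t) * h2 t - r * sin t * h1 t + (s - 1) * h1 t + g1 t)) ->
  (forall t, is_derive g1 t (- (r * cos t) * g1 t + r * sin t * g2 t - (s - 1) * g2 t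
     + r ^ 2 * (cos (2 * t) * h2 t + sin (2 * t) * h1 t) + 2 * nu * g2 t)) ->
  (forall t, is_derive g2 t (- (r * cos t) * g2 t - r * sin t * g1 t + (s - 1) * g1 t
     - r ^ 2 * (cos (2 * t) * h1 t - sin (2 * t) * h2 t) - 2 * nu * g1 t)) ->
  let A1 t := g1 t + s * h1 t + (r * sin t * h1 t + r * cos t * h2 t) in
  let A2 t := g2 t + s * h2 t + (r * sin t * h2 t - r * cos t * h1 t) in
  let B1 t := g1 t + s * h1 t - (r * sin t * h1 t + r * cos t * h2 t) in
  let B2 t := g2 t + s * h2 t - (r * sin t * h2 t - r * cos t * h1 t) in
  forall ca sa, Rabs ca <= 1 -> Rabs sa <= 1 ->
  Rabs ((ca * A2 (PI / 2) - sa * A1 (PI / 2)) - (ca * A2 0 - sa * A1 0)) <=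
  4 * Rabs (s * (s - 1))
    * (1 + (A1 0 ^ 2 + A2 0 ^ 2 + B1 0 ^ 2 + B2 0 ^ 2) * exp (4 * Rabs (s * (s - 1)))) / r.
Proof.
  intros Hs Hr Hh1 Hh2 Hg1 Hg2 A1 A2 B1 B2 ca sa Hca Hsa.
  assert (Hc2 : forall t, cos (2 * t) = cos t * cos t - sin t * sin t).
  { intros t. rewrite cos_2a. ring. }
  assert (Hs2 : forall t, sin (2 * t) = 2 * sin t * cos t) by (intros t; apply sin_2a).
  set (m := s * (s - 1)).
  assert (Hx : forall t, is_derive (fun t => r * cos t) t (- (r * sin t))).
  { intros t. auto_derive; [exact I | ring]. }
  assert (Hy : forall t, is_derive (fun t => r * sin t) t (r * cos t)).
  { intros t. auto_derive; [exact I | ring]. }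
  pose proof (fun t => is_derive_Rplus _ _ _ _ _ (Hg1 t) (is_derive_scal _ _ s _ (Hh1 t))) as Hgs1.
  pose proof (fun t => is_derive_Rplus _ _ _ _ _ (Hg2 t) (is_derive_scal _ _ s _ (Hh2 t))) as Hgs2.
  pose proof (fun t => is_derive_Rplus _ _ _ _ _ (is_derive_Rmult _ _ _ _ _ (Hy t) (Hh1 t))
                         (is_derive_Rmult _ _ _ _ _ (Hx t) (Hh2 t))) as Hw1.
  pose proof (fun t => is_derive_Rminus _ _ _ _ _ (is_derive_Rmult _ _ _ _ _ (Hy t) (Hh2 t))
                         (is_derive_Rmult _ _ _ _ _ (Hx t) (Hh1 t))) as Hw2.
  assert (HA1 : forall t, is_derive A1 t (- m * h2 t)).
  { intros t. eapply is_derive_value; [exact (is_derive_Rplus _ _ _ _ _ (Hgs1 t) (Hw1 t)) | ].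
    cbv beta. unfold m. rewrite Hc2, Hs2. subst s. field. }
  assert (HA2 : forall t, is_derive A2 t (m * h1 t)).
  { intros t. eapply is_derive_value; [exact (is_derive_Rplus _ _ _ _ _ (Hgs2 t) (Hw2 t)) | ].
    cbv beta. unfold m. rewrite Hc2, Hs2. subst s. field. }
  assert (HB1 : forall t, is_derive B1 t
            (- 2 * (r * cos t * B1 t - r * sin t * B2 t) - m * h2 t)).
  { intros t. eapply is_derive_value; [exact (is_derive_Rminus _ _ _ _ _ (Hgs1 t) (Hw1 t)) | ].
    cbv beta. unfold m, B1, B2. rewrite Hc2, Hs2. subst s. field. }
  assert (HB2 : forall t, is_derive B2 t
            (- 2 * (r * cos t * B2 t + r * sin t * B1 t) + m * h1 t)).
  { intros t. eapply is_derive_value; [exact (is_derive_Rminus _ _ _ _ _ (Hgs2 t) (Hw2 t)) | ].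
    cbv beta. unfold m, B1, B2. rewrite Hc2, Hs2. subst s. field. }
  (* S = |A|^2 + |B|^2 is the energy to which Gronwall's inequality is applied; [m] equals nu^2 -
     1/4. *)
  set (S := fun t => A1 t * A1 t + A2 t * A2 t + (B1 t * B1 t + B2 t * B2 t)).
  assert (HS : forall t, is_derive S t (- 4 * (r * cos t) * (B1 t * B1 t + B2 t * B2 t)
            + 2 * m * (h1 t * (A2 t + B2 t) - h2 t * (A1 t + B1 t)))).
  { intros t. eapply is_derive_value.
    - exact (is_derive_Rplus _ _ _ _ _
        (is_derive_Rplus _ _ _ _ _ (is_derive_Rmult _ _ _ _ _ (HA1 t) (HA1 t))
                                   (is_derive_Rmult _ _ _ _ _ (HA2 t) (HA2 t)))
        (is_derive_Rplus _ _ _ _ _ (is_derive_Rmult _ _ _ _ _ (HB1 t) (HB1 t))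
                                   (is_derive_Rmult _ _ _ _ _ (HB2 t) (HB2 t)))).
    - cbv beta. ring. }
  (* B - A = 2 i z h with |z| = r. This is the source of the gain 1/r: h is smaller than A and B by
     a factor r. *)
  assert (Hh : forall t, 2 * r ^ 2 * (h1 t * h1 t + h2 t * h2 t) <= S t).
  { intros t. unfold S.
    assert (E : (B1 t - A1 t) ^ 2 + (B2 t - A2 t) ^ 2 = 4 * r ^ 2 * (h1 t * h1 t + h2 t * h2 t)).
    { unfold A1, A2, B1, B2.
      replace (4 * r ^ 2 * (h1 t * h1 t + h2 t * h2 t))
        with (4 * r ^ 2 * (h1 t * h1 t + h2 t * h2 t) * (Rsqr (sin t) + Rsqr (cos t))).
      - unfold Rsqr. ring.
      - rewrite sin2_cos2. ring. }
    generalize (pow2_ge_0 (B1 t + A1 t)) (pow2_ge_0 (B2 t + A2 t)). nra. }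
  set (am := Rabs m).
  assert (Ham : 0 <= am) by apply Rabs_pos.
  (* On the quarter circle cos t >= 0, so the damping term has a favourable sign and is dropped. The
     rest is a multiple of h (A + B), hence O(S / r). *)
  assert (HSle : forall t, 0 <= t <= PI / 2 ->
     - 4 * (r * cos t) * (B1 t * B1 t + B2 t * B2 t)
     + 2 * m * (h1 t * (A2 t + B2 t) - h2 t * (A1 t + B1 t)) <= 2 * am / r * S t).
  { intros t Ht.
    assert (Hcos : 0 <= cos t) by (apply cos_ge_0; lra).
    assert (H1 : 0 <= 4 * (r * cos t) * (B1 t * B1 t + B2 t * B2 t)).
    { apply Rmult_le_pos; [nra | ]. nra. }
    assert (H2 : 2 * m * (h1 t * (A2 t + B2 t) - h2 t * (A1 t + B1 t))
              <= am * (2 * Rabs (h1 t * (A2 t + B2 t) - h2 t * (A1 t + B1 t)))).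
    { apply Rle_trans with (1 := Rle_abs _). rewrite !Rabs_mult, (Rabs_pos_eq 2) by lra.
      unfold am. right. ring. }
    assert (H3 : 2 * Rabs (h1 t * (A2 t + B2 t) - h2 t * (A1 t + B1 t)) <= 2 / r * S t).
    { assert (Hr2 : 2 * r * Rabs (h1 t * (A2 t + B2 t) - h2 t * (A1 t + B1 t)) <= 2 * S t).
      { specialize (Hh t). unfold S in *.
        set (p := r * h1 t). set (q := r * h2 t).
        assert (Hpq : 2 * (p * p + q * q) <=
           A1 t * A1 t + A2 t * A2 t + (B1 t * B1 t + B2 t * B2 t)) by (unfold p, q; nra).
        replace (2 * r * Rabs (h1 t * (A2 t + B2 t) - h2 t * (A1 t + B1 t)))
          with (2 * Rabs (p * (A2 t + B2 t) - q * (A1 t + B1 t))).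
        2: { unfold p, q.
             replace (r * h1 t * (A2 t + B2 t) - r * h2 t * (A1 t + B1 t))
               with (r * (h1 t * (A2 t + B2 t) - h2 t * (A1 t + B1 t))) by ring.
             rewrite (Rabs_mult r), (Rabs_pos_eq r) by lra. ring. }
        generalize (pow2_ge_0 (p - A2 t)) (pow2_ge_0 (p - B2 t)) (pow2_ge_0 (q + A1 t))
          (pow2_ge_0 (q + B1 t)) (pow2_ge_0 (p + A2 t)) (pow2_ge_0 (p + B2 t))
          (pow2_ge_0 (q - A1 t)) (pow2_ge_0 (q - B1 t)). intros.
        unfold Rabs; destruct Rcase_abs; nra. }
      apply Rmult_le_reg_l with r; [lra | ].
      replace (r * (2 / r * S t)) with (2 * S t) by (field; lra). lra. }
    replace (2 * am / r * S t) with (am * (2 / r * S t)) by (field; lra).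
    assert (am * (2 * Rabs (h1 t * (A2 t + B2 t) - h2 t * (A1 t + B1 t)))
             <= am * (2 / r * S t)) by now apply Rmult_le_compat_l.
    lra. }
  assert (HPI := PI_RGT_0). assert (HPI4 := PI_4).
  (* The exponent 2 am t / r is at most 4 am because r >= 1 and t <= PI / 2 <= 2. *)
  assert (HSb : forall t, 0 <= t <= PI / 2 -> S t <= S 0 * exp (4 * am)).
  { intros t Ht.
    assert (HG := gronwall S _ (fun t => 2 * am / r * t) (fun _ => 2 * am / r) 0 t
       ltac:(lra) (fun t _ => HS t)).
    assert (HS0 : 0 <= S 0) by (unfold S; nra).
    apply Rle_trans with (S 0 * exp (2 * am / r * t - 2 * am / r * 0)).
    - apply HG.
      + intros w _. auto_derive; [exact I | ring].
      + intros w Hw. apply HSle. lra.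
    - apply Rmult_le_compat_l; trivial.
      assert (2 * am / r * t <= 4 * am).
      { apply Rle_trans with (2 * am * t).
        - apply Rmult_le_compat_r; [lra | ]. apply Rmult_le_reg_r with r; [lra | ].
          unfold Rdiv. rewrite Rmult_assoc, Rinv_l by lra. nra.
        - nra. }
      destruct (Req_dec (2 * am / r * t - 2 * am / r * 0) (4 * am)) as [->|Hne]; [lra | ].
      apply Rlt_le, exp_increasing. lra. }
  destruct (MVT_interval (fun t => ca * A2 t - sa * A1 t)
     (fun t => ca * (m * h1 t) - sa * (- m * h2 t)) 0 (PI / 2)) as [c [Hc Hc']]; [lra | | ].
  { intros t _. exact (is_derive_Rminus _ _ _ _ _ (is_derive_scal _ _ ca _ (HA2 t))
                         (is_derive_scal _ _ sa _ (HA1 t))). }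
  rewrite Hc'. rewrite Rminus_0_r, Rabs_mult, (Rabs_pos_eq (PI / 2)) by lra.
  assert (Hb : Rabs (ca * (m * h1 c) - sa * (- m * h2 c)) <= am * (Rabs (h1 c) + Rabs (h2 c))).
  { replace (ca * (m * h1 c) - sa * (- m * h2 c)) with (m * (ca * h1 c + sa * h2 c)) by ring.
    rewrite Rabs_mult. apply Rmult_le_compat_l; trivial.
    apply Rle_trans with (1 := Rabs_triang _ _). rewrite !Rabs_mult.
    generalize (Rabs_pos (h1 c)) (Rabs_pos (h2 c)). nra. }
  (* Uses y <= y^2 + 1/4 for y = r |h1| and y = r |h2|, which avoids square roots of [S]. *)
  assert (Hrh : r * (Rabs (h1 c) + Rabs (h2 c)) <= 1 + S 0 * exp (4 * am)).
  { specialize (Hh c). specialize (HSb c Hc).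
    assert (E1 := pow2_abs (h1 c)). assert (E2 := pow2_abs (h2 c)).
    set (p := Rabs (h1 c)) in *. set (q := Rabs (h2 c)) in *.
    generalize (pow2_ge_0 (r * p - 1 / 2)) (pow2_ge_0 (r * q - 1 / 2)). nra. }
  replace (A1 0 ^ 2 + A2 0 ^ 2 + B1 0 ^ 2 + B2 0 ^ 2) with (S 0) by (unfold S; ring).
  fold am. set (Q := 1 + S 0 * exp (4 * am)) in *.
  set (hh := Rabs (h1 c) + Rabs (h2 c)) in *.
  assert (0 <= hh) by (unfold hh; generalize (Rabs_pos (h1 c)) (Rabs_pos (h2 c)); lra).
  apply Rle_trans with (am * hh * 4).
  - apply Rmult_le_compat; try lra. apply Rabs_pos.
  - apply Rmult_le_reg_r with r; [lra | ].
    unfold Rdiv. rewrite (Rmult_assoc _ (/ r) r), Rinv_l by lra.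
    assert (am * (r * hh) <= am * Q) by now apply Rmult_le_compat_l. lra.
Qed.

(** * Liouville normal form on the real axis: u'' = (-1 + (nu^2 - 1/4) / x^2) u *)

Definition osc (nu x : R) : R := Rpower x (1 / 2) * cyl nu x.

(** The derivative of [osc nu]. *)
Definition osc1 (nu x : R) : R := Rpower x (- (1 / 2)) * (cyl1 nu x + cyl nu x / 2).

Lemma trig_series_cos_0 (b : nat -> R) : trig_series cos b 0 = Series b.
Proof.
  apply Series_ext. intros m. rewrite Rmult_0_r, cos_0. ring.
Qed.

Lemma Series_zero (a : nat -> R) : (forall n, a n = 0) -> Series a = 0.
Proof.
  intros H. rewrite (Series_ext a (fun n => 0 * a n)).
  - rewrite Series_scal_l. ring.
  - intros n. rewrite H. ring.
Qed.

Lemma trig_series_sin_0 (b : nat -> R) : trig_series sin b 0 = 0.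
Proof.
  apply Series_zero. intros m. rewrite Rmult_0_r, sin_0. ring.
Qed.

Lemma trig_series_sin_PI2 (b : nat -> R) : trig_series sin b (PI / 2) = 0.
Proof.
  apply Series_zero. intros m. rewrite (sin_eq_0_1 (2 * INR m * (PI / 2))); [ring | ].
  exists (Z.of_nat m). rewrite <- INR_IZR_INZ. field.
Qed.

(** Evaluates z f' at the real end z = r of the arc. *)
Lemma Series_arc_coef1 (nu r : R) : 0 <= nu ->
  Series (fun m => 2 * INR m * arc_coef nu r m)
  = - (r ^ 2 / (2 * (nu + 1)) * phi (nu + 1) (r ^ 2)).
Proof.
  intros Hnu. rewrite Series_incr_1.
  - simpl (INR 0). rewrite Rmult_0_r, Rmult_0_l, Rplus_0_l.
    unfold phi, PSeries. rewrite <- Series_scal_l, <- Series_opp.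
    apply Series_ext. intros m. unfold arc_coef.
    replace (2 * INR (S m) * (bcoef nu (S m) * (r ^ 2) ^ S m))
      with (2 * (INR (S m) * bcoef nu (S m)) * (r ^ 2) ^ S m) by ring.
    rewrite bcoef_succ_order by exact Hnu. simpl pow. field. lra.
  - refine (ex_series_Rabs_le _ _ _ (arc_coef1_summable nu r Hnu)). intros m.
    rewrite <- (Rmult_1_r (Rabs (2 * INR m * arc_coef nu r m))) at 1.
    apply Rmult_le_compat_l; [apply Rabs_pos | apply weight_le_pow4].
Qed.

Lemma arc_phase (nu r : R) : 0 <= nu -> 1 <= r ->
  let mu := Rabs ((nu + 1 / 2) * (nu + 1 / 2 - 1)) in
  let psi := PI / 2 * (nu - 1 / 2) in
  Rabs (osc1 nu r * sin (r - psi) - osc nu r * cos (r - psi)) <=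
  4 * mu * (1 + 2 * (osc nu r ^ 2 + osc1 nu r ^ 2) * exp (4 * mu)) / r.
Proof.
  intros Hnu Hr mu psi.
  set (s := nu + 1 / 2).
  (* E1 + i E2 is exp(iz) z^(s-1) on the arc z = r exp(it), with modulus r^(s-1) exp(-r sin t);
     below, Pf + i Qf is f and Pg + i Qg is z f'. *)
  set (rho := Rpower r (s - 1)).
  set (E1 := fun t => rho * exp (- (r * sin t)) * cos (r * cos t + (s - 1) * t)).
  set (E2 := fun t => rho * exp (- (r * sin t)) * sin (r * cos t + (s - 1) * t)).
  assert (HE1 : forall t, is_derive E1 t
     (- (r * cos t) * E1 t + r * sin t * E2 t - (s - 1) * E2 t)).
  { intros t. unfold E1, E2. auto_derive; [exact I | ring]. }
  assert (HE2 : forall t, is_derive E2 t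
     (- (r * cos t) * E2 t - r * sin t * E1 t + (s - 1) * E1 t)).
  { intros t. unfold E1, E2. auto_derive; [exact I | ring]. }
  set (b := arc_coef nu r). set (b1 := fun m => 2 * INR m * b m).
  set (Pf := trig_series cos b). set (Qf := trig_series sin b).
  set (Pg := trig_series cos b1). set (Qg := trig_series sin b1).
  assert (Hsum : ex_series (fun m => Rabs (b m) * 4 ^ m)) by (apply arc_coef_summable; lra).
  assert (Hsum1 : ex_series (fun m => Rabs (b1 m) * 4 ^ m)) by now apply arc_coef1_summable.
  assert (HPf : forall t, is_derive Pf t (- Qg t)).
  { intros t. eapply is_derive_value.
    - exact (is_derive_trig_series _ _ b t lipschitz_C1_cos Hsum).
    - apply trig_series_opp_sin. }
  assert (HQf : forall t, is_derive Qf t (Pg t)).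
  { intros t. exact (is_derive_trig_series _ _ b t lipschitz_C1_sin Hsum). }
  assert (HPg : forall t, is_derive Pg t
     (r ^ 2 * (cos (2 * t) * Qf t + sin (2 * t) * Pf t) + 2 * nu * Qg t)).
  { intros t. eapply is_derive_value.
    - exact (is_derive_trig_series _ _ b1 t lipschitz_C1_cos Hsum1).
    - rewrite trig_series_opp_sin. unfold b1 at 1, b at 1.
      rewrite arc_coef_recurrence, arc_shift_sin; trivial; [ | apply lipschitz_C1_sin].
      fold b. fold b1. fold Qg Qf Pf. ring. }
  assert (HQg : forall t, is_derive Qg t
     (- (r ^ 2 * (cos (2 * t) * Pf t - sin (2 * t) * Qf t)) - 2 * nu * Pg t)).
  { intros t. eapply is_derive_value.
    - exact (is_derive_trig_series _ _ b1 t lipschitz_C1_sin Hsum1).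
    - unfold b1 at 1, b at 1.
      rewrite arc_coef_recurrence, arc_shift_cos; trivial; [ | apply lipschitz_C1_cos].
      fold b. fold b1. fold Pg Qf Pf. ring. }
  assert (HT := arc_transport nu s r
    (fun t => E1 t * Pf t - E2 t * Qf t) (fun t => E1 t * Qf t + E2 t * Pf t)
    (fun t => E1 t * Pg t - E2 t * Qg t) (fun t => E1 t * Qg t + E2 t * Pg t) eq_refl Hr).
  cbv beta in HT.
  specialize (HT
    ltac:(intros t; eapply is_derive_value;
      [exact (is_derive_Rminus _ _ _ _ _ (is_derive_Rmult _ _ _ _ _ (HE1 t) (HPf t))
                (is_derive_Rmult _ _ _ _ _ (HE2 t) (HQf t))) | cbv beta; ring])).
  specialize (HT
    ltac:(intros t; eapply is_derive_value;
      [exact (is_derive_Rplus _ _ _ _ _ (is_derive_Rmult _ _ _ _ _ (HE1 t) (HQf t))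
                (is_derive_Rmult _ _ _ _ _ (HE2 t) (HPf t))) | cbv beta; ring])).
  specialize (HT
    ltac:(intros t; eapply is_derive_value;
      [exact (is_derive_Rminus _ _ _ _ _ (is_derive_Rmult _ _ _ _ _ (HE1 t) (HPg t))
                (is_derive_Rmult _ _ _ _ _ (HE2 t) (HQg t))) | cbv beta; ring])).
  specialize (HT
    ltac:(intros t; eapply is_derive_value;
      [exact (is_derive_Rplus _ _ _ _ _ (is_derive_Rmult _ _ _ _ _ (HE1 t) (HQg t))
                (is_derive_Rmult _ _ _ _ _ (HE2 t) (HPg t))) | cbv beta; ring])).
  (* This selects the imaginary part of exp(-i psi) A. At t = PI / 2 it vanishes, because there -iz
     = r and the series are real, so A is a real multiple of exp(i psi). At t = 0 one has A =
     exp(ir) (u' - i u), which gives the left side of the statement. *)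
  specialize (HT (cos psi) (sin psi)).
  cbv beta zeta in HT.
  specialize (HT (Rabs_le _ _ (COS_bound psi)) (Rabs_le _ _ (SIN_bound psi))).
  assert (Hpsi : r * cos (PI / 2) + (s - 1) * (PI / 2) = psi).
  { rewrite cos_PI2. unfold psi, s. field. }
  assert (HE1' : E1 (PI / 2) = rho * exp (- r) * cos psi).
  { unfold E1. rewrite Hpsi, sin_PI2, Rmult_1_r. reflexivity. }
  assert (HE2' : E2 (PI / 2) = rho * exp (- r) * sin psi).
  { unfold E2. rewrite Hpsi, sin_PI2, Rmult_1_r. reflexivity. }
  assert (HE10 : E1 0 = rho * cos r).
  { unfold E1. rewrite sin_0, cos_0, !Rmult_0_r, Ropp_0, exp_0, !Rmult_1_r, Rplus_0_r.
    reflexivity. }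
  assert (HE20 : E2 0 = rho * sin r).
  { unfold E2. rewrite sin_0, cos_0, !Rmult_0_r, Ropp_0, exp_0, !Rmult_1_r, Rplus_0_r.
    reflexivity. }
  assert (HPf0 : Pf 0 = phi nu (r ^ 2)) by apply trig_series_cos_0.
  assert (HPg0 : Pg 0 = - (r ^ 2 / (2 * (nu + 1)) * phi (nu + 1) (r ^ 2))).
  { unfold Pg. rewrite trig_series_cos_0. now apply Series_arc_coef1. }
  assert (HQf0 : Qf 0 = 0) by apply trig_series_sin_0.
  assert (HQg0 : Qg 0 = 0) by apply trig_series_sin_0.
  assert (HQf1 : Qf (PI / 2) = 0) by apply trig_series_sin_PI2.
  assert (HQg1 : Qg (PI / 2) = 0) by apply trig_series_sin_PI2.
  rewrite HE1', HE2', HE10, HE20, HPf0, HPg0, HQf0, HQg0, HQf1, HQg1,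
    sin_PI2, cos_PI2, sin_0, cos_0 in HT.
  set (f0 := phi nu (r ^ 2)) in *. set (f1 := phi (nu + 1) (r ^ 2)) in *.
  assert (HR : Rpower r nu * Rpower r (- (1 / 2)) = rho).
  { unfold rho, s. rewrite <- Rpower_plus. f_equal. field. }
  assert (HR' : Rpower r nu * Rpower r (1 / 2) = rho * r).
  { rewrite <- (Rpower_1 r) at 3 by lra. unfold rho, s. rewrite <- !Rpower_plus. f_equal. field. }
  assert (HU : osc nu r = rho * r * f0).
  { unfold osc, cyl. rewrite <- HR'. unfold f0. ring. }
  assert (HV : osc1 nu r = rho * (s * f0 - r ^ 2 / (2 * (nu + 1)) * f1)).
  { unfold osc1, cyl, cyl1. rewrite <- HR. unfold f0, f1, s. field. lra. }
  rewrite sin_minus, cos_minus.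
  set (U := osc nu r) in *. set (V := osc1 nu r) in *.
  rewrite Rabs_minus_sym in HT.
  match type of HT with Rabs ?l <= ?rr =>
    replace l with (V * (sin r * cos psi - cos r * sin psi)
      - U * (cos r * cos psi + sin r * sin psi)) in HT end.
  2: { rewrite HU, HV. ring. }
  apply Rle_trans with (1 := HT). right. fold s. fold mu.
  do 4 f_equal.
  (* At t = 0, A and B are exp(ir) (V - iU) and exp(ir) (V + iU), so |A|^2 + |B|^2 = 2 (U^2 +
     V^2). *)
  replace (U ^ 2 + V ^ 2) with ((U ^ 2 + V ^ 2) * (Rsqr (sin r) + Rsqr (cos r))).
  2: { rewrite sin2_cos2. ring. }
  rewrite HU, HV. unfold Rsqr. ring.
Qed.

Lemma osc_system (nu x : R) : 0 <= nu -> 0 < x ->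
  is_derive (osc nu) x (osc1 nu x) /\
  is_derive (osc1 nu) x ((- 1 + (nu ^ 2 - 1 / 4) / x ^ 2) * osc nu x).
Proof.
  intros Hnu Hx. destruct (cyl_system nu Hnu x Hx) as [H0 H1].
  assert (HR : Rpower x (1 / 2 - 1) = Rpower x (- (1 / 2))) by (f_equal; field).
  assert (HR1 : Rpower x (1 / 2) = Rpower x (- (1 / 2)) * x).
  { rewrite <- (Rpower_1 x Hx) at 3. rewrite <- Rpower_plus. f_equal. field. }
  assert (HR2 : Rpower x (- (1 / 2) - 1) = Rpower x (- (1 / 2)) / x).
  { unfold Rminus. rewrite Rpower_plus, (Rpower_Ropp x 1), Rpower_1; trivial. }
  split; eapply is_derive_value.
  - exact (is_derive_Rmult _ _ _ _ _ (is_derive_Rpower_l (1 / 2) x Hx) H0).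
  - cbv beta. unfold osc1. rewrite HR, HR1. field. lra.
  - assert (H2 : is_derive (fun x => cyl1 nu x + cyl nu x / 2) x
       ((nu ^ 2 - x ^ 2) / x * cyl nu x + cyl1 nu x / x * / 2)).
    { apply is_derive_Rplus; trivial.
      eapply is_derive_value; [exact (is_derive_Rmult _ _ _ _ _ H0 (is_derive_const (/ 2) x)) | ].
      unfold zero; simpl. ring. }
    exact (is_derive_Rmult _ _ _ _ _ (is_derive_Rpower_l (- (1 / 2)) x Hx) H2).
  - cbv beta. unfold osc. rewrite HR2, HR1. field. lra.
Qed.

(** N = u^2 + u'^2 satisfies |N'| <= |m| N / x^2, and 1/x^2 has integral 1 over x >= 1; so N stays
    within a factor exp(|m|) of N(1). *)
Lemma osc_modulus_bounds (nu : R) : 0 <= nu ->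
  exists c M, 0 < c /\ forall x, 1 <= x -> c <= osc nu x ^ 2 + osc1 nu x ^ 2 <= M.
Proof.
  intros Hnu. set (m := nu ^ 2 - 1 / 4).
  set (N := fun x => osc nu x * osc nu x + osc1 nu x * osc1 nu x).
  assert (HN : forall x, 0 < x -> is_derive N x (2 * m / x ^ 2 * (osc nu x * osc1 nu x))).
  { intros x Hx. destruct (osc_system nu x Hnu Hx) as [H0 H1].
    eapply is_derive_value.
    - exact (is_derive_Rplus _ _ _ _ _ (is_derive_Rmult _ _ _ _ _ H0 H0)
               (is_derive_Rmult _ _ _ _ _ H1 H1)).
    - cbv beta. fold m. field. lra. }
  assert (Hb : forall x, 0 < x ->
    Rabs (2 * m / x ^ 2 * (osc nu x * osc1 nu x)) <= Rabs m / x ^ 2 * N x).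
  { intros x Hx. unfold N.
    replace (2 * m / x ^ 2 * (osc nu x * osc1 nu x))
      with (m * (2 * (osc nu x * osc1 nu x)) * / x ^ 2) by (field; lra).
    assert (Hi : 0 < / x ^ 2) by (apply Rinv_0_lt_compat; nra).
    rewrite !Rabs_mult, (Rabs_pos_eq (/ x ^ 2)), (Rabs_pos_eq 2) by lra.
    replace (Rabs m / x ^ 2 * (osc nu x * osc nu x + osc1 nu x * osc1 nu x))
      with (Rabs m * (osc nu x * osc nu x + osc1 nu x * osc1 nu x) * / x ^ 2) by (field; lra).
    apply Rmult_le_compat_r; [lra | ]. apply Rmult_le_compat_l; [apply Rabs_pos | ].
    rewrite <- (Rabs_mult (osc nu x)).
    generalize (pow2_ge_0 (osc nu x - osc1 nu x)) (pow2_ge_0 (osc nu x + osc1 nu x)). intros.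
    unfold Rabs; destruct Rcase_abs; nra. }
  assert (Hm : 0 <= Rabs m) by apply Rabs_pos.
  assert (HN1 : 0 < N 1).
  { assert (HL := lommel_pos nu 1 Hnu ltac:(lra)).
    unfold N, osc, osc1.
    assert (E : forall p, Rpower 1 p = 1).
    { intros p. unfold Rpower. rewrite ln_1, Rmult_0_r. apply exp_0. }
    rewrite !E, !Rmult_1_l.
    destruct (Req_dec (cyl nu 1) 0) as [H0|H0]; [ | nra].
    assert (H1 := cyl1_neq_0 nu 1 Hnu ltac:(lra) H0). rewrite H0. nra. }
  assert (HK : forall a x, 0 < x -> is_derive (fun t => - (a / t)) x (a / x ^ 2)).
  { intros a x Hx. auto_derive; [lra | field; lra]. }
  exists (N 1 * exp (- Rabs m)), (N 1 * exp (Rabs m)).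
  split; [apply Rmult_lt_0_compat; [trivial | apply exp_pos] | ].
  intros x Hx.
  replace (osc nu x ^ 2 + osc1 nu x ^ 2) with (N x) by (unfold N; ring).
  assert (Hinv : 0 <= Rabs m / x) by (apply Rdiv_le_0_compat; lra).
  assert (Hexp : forall p q, p <= q -> exp p <= exp q).
  { intros p q [H|H]; [now apply Rlt_le, exp_increasing | rewrite H; lra]. }
  split.
  (* The lower bound is Gronwall's inequality for -N with the negative rate -|m| / x^2. *)
  - assert (HG := gronwall (fun x => - N x) (fun x => - (2 * m / x ^ 2 * (osc nu x * osc1 nu x)))
       (fun t => - (- Rabs m / t)) (fun t => - Rabs m / t ^ 2) 1 x Hx).
    cbv beta in HG.
    assert (H : - N x <= - N 1 * exp (- (- Rabs m / x) - - (- Rabs m / 1))).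
    { apply HG.
      - intros t Ht. exact (is_derive_opp N t _ (HN t ltac:(lra))).
      - intros t Ht. apply HK. lra.
      - intros t Ht. assert (H := Hb t ltac:(lra)). apply Rabs_le_between in H.
        replace (- Rabs m / t ^ 2 * - N t) with (Rabs m / t ^ 2 * N t) by (field; lra). lra. }
    assert (H' : exp (- Rabs m) <= exp (- (- Rabs m / x) - - (- Rabs m / 1))).
    { apply Hexp. replace (- (- Rabs m / x)) with (Rabs m / x) by (field; lra).
      replace (- (- Rabs m / 1)) with (Rabs m) by field. lra. }
    nra.
  - assert (HG := gronwall N (fun x => 2 * m / x ^ 2 * (osc nu x * osc1 nu x))
       (fun t => - (Rabs m / t)) (fun t => Rabs m / t ^ 2) 1 x Hx).
    cbv beta in HG.
    assert (H : N x <= N 1 * exp (- (Rabs m / x) - - (Rabs m / 1))).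
    { apply HG.
      - intros t Ht. apply HN. lra.
      - intros t Ht. apply HK. lra.
      - intros t Ht. assert (H := Hb t ltac:(lra)). apply Rabs_le_between in H. lra. }
    assert (H' : exp (- (Rabs m / x) - - (Rabs m / 1)) <= exp (Rabs m)).
    { apply Hexp. replace (- (Rabs m / 1)) with (- Rabs m) by field. lra. }
    nra.
Qed.

Lemma phase_bound (nu : R) : 0 <= nu ->
  exists C, 0 < C /\ forall x, 1 <= x ->
    Rabs (osc1 nu x * sin (x - PI / 2 * (nu - 1 / 2))
          - osc nu x * cos (x - PI / 2 * (nu - 1 / 2))) <= C / x.
Proof.
  intros Hnu. destruct (osc_modulus_bounds nu Hnu) as (c & M & Hc & HM).
  set (mu := Rabs ((nu + 1 / 2) * (nu + 1 / 2 - 1))).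
  assert (Hmu : 0 <= mu) by apply Rabs_pos.
  assert (HM0 : 0 <= M) by (generalize (HM 1 ltac:(lra)); lra).
  assert (Hexp := exp_pos (4 * mu)).
  assert (Hpos : 0 <= M * exp (4 * mu)) by (apply Rmult_le_pos; lra).
  (* The added 1 keeps the constant positive when mu = 0, that is for nu = 1/2. *)
  exists (4 * mu * (1 + 2 * M * exp (4 * mu)) + 1). split; [nra | ].
  intros x Hx. apply Rle_trans with (1 := arc_phase nu x Hnu Hx). cbv zeta. fold mu.
  apply Rmult_le_compat_r; [apply Rlt_le, Rinv_0_lt_compat; lra | ].
  apply Rle_trans with (4 * mu * (1 + 2 * M * exp (4 * mu))); [ | lra].
  apply Rmult_le_compat_l; [lra | ]. apply Rplus_le_compat_l.
  apply Rmult_le_compat_r; [lra | ]. generalize (HM x Hx). lra.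
Qed.

(** * Location and indexing *)

Lemma sin_IZR_PI (j : Z) : sin (IZR j * PI) = 0.
Proof. apply sin_eq_0_1. now exists j. Qed.

(** A crude Jordan inequality: up to PI / 3 the cosine is at least 1/2, and beyond it sin w >= 1/2
    while w <= 2. *)
Lemma sin_ge_quarter (w : R) : 0 <= w <= PI / 2 -> w <= 4 * sin w.
Proof.
  intros Hw. assert (HPI := PI_RGT_0). assert (HPI4 := PI_4).
  destruct (Rle_dec w (PI / 3)) as [H|H].
  - destruct (MVT_interval sin cos 0 w) as [c [Hc E]]; [lra | | ].
    + intros x _. auto_derive; [exact I | ring].
    + rewrite sin_0, !Rminus_0_r in E. rewrite E.
      assert (cos (PI / 3) <= cos c).
      { apply cos_decr_1; lra. }
      rewrite cos_PI3 in H0. nra.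
  - assert (sin (PI / 6) <= sin w) by (apply sin_incr_1; lra).
    rewrite sin_PI6 in H0. lra.
Qed.

Lemma near_sin_zero (t e : R) : Rabs (sin t) <= e ->
  exists j : Z, Rabs (t - PI * IZR j) <= 4 * e.
Proof.
  intros He. assert (HPI := PI_RGT_0).
  (* [k - 1] is the integer nearest to t / PI. *)
  destruct (archimed (t / PI + 1 / 2)) as [H1 H2].
  set (k := up (t / PI + 1 / 2)) in *. exists (k - 1)%Z.
  rewrite minus_IZR. set (w := t - PI * (IZR k - 1)).
  assert (Hw : - (PI / 2) <= w <= PI / 2).
  { unfold w. replace t with (t / PI * PI) by (field; lra). nra. }
  assert (Hs : Rabs (sin w) = Rabs (sin t)).
  { unfold w. rewrite (Rmult_comm PI), <- minus_IZR, sin_minus, sin_IZR_PI, Rmult_0_r, Rminus_0_r.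
    assert (H := sin2_cos2 (IZR (k - 1) * PI)). rewrite sin_IZR_PI in H. unfold Rsqr in H.
    rewrite Rabs_mult. replace (Rabs (cos (IZR (k - 1) * PI))) with 1; [ring | ].
    symmetry. apply Rsqr_inj; [apply Rabs_pos | lra | ].
    rewrite <- Rsqr_abs. unfold Rsqr. lra. }
  rewrite <- Hs in He.
  destruct (Rle_dec 0 w) as [H|H].
  - assert (Hg := sin_ge_quarter w ltac:(lra)). generalize (Rle_abs (sin w)).
    rewrite (Rabs_pos_eq w) by lra. lra.
  - assert (Hg := sin_ge_quarter (- w) ltac:(lra)). rewrite sin_neg in Hg.
    generalize (Rle_abs (- sin w)). rewrite Rabs_Ropp, (Rabs_left1 w) by lra. lra.
Qed.

(** At a zero only the term u' sin(x - psi) survives in the phase estimate, and |u'| is bounded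
    below there by the modulus bound. *)
Lemma zero_location (nu : R) : 0 <= nu ->
  exists C, 0 <= C /\ forall x, 1 <= x -> cyl nu x = 0 ->
    exists j : Z, Rabs (x - PI * (IZR j + (nu / 2 + 3 / 4))) <= C / x.
Proof.
  intros Hnu. destruct (phase_bound nu Hnu) as [C [HC Hph]].
  destruct (osc_modulus_bounds nu Hnu) as (c & M & Hc & HM).
  assert (Hsc : 0 < sqrt c) by now apply sqrt_lt_R0.
  exists (4 * (C / sqrt c)).
  assert (HCc : 0 < C / sqrt c) by now apply Rdiv_lt_0_compat.
  split; [lra | ]. intros x Hx Hz.
  specialize (Hph x Hx). destruct (HM x Hx) as [Hl _].
  set (psi := PI / 2 * (nu - 1 / 2)) in *.
  assert (HU : osc nu x = 0) by (unfold osc; rewrite Hz; ring).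
  rewrite HU, Rmult_0_l, Rminus_0_r, Rabs_mult in Hph.
  rewrite HU in Hl.
  assert (HV : sqrt c <= Rabs (osc1 nu x)).
  { apply sqrt_le_1_alt in Hl. replace (0 ^ 2 + osc1 nu x ^ 2) with (Rsqr (osc1 nu x)) in Hl
      by (unfold Rsqr; ring). now rewrite sqrt_Rsqr_abs in Hl. }
  assert (Hsin : Rabs (sin (x - psi)) <= C / sqrt c / x).
  { apply Rmult_le_reg_l with (sqrt c); trivial.
    replace (sqrt c * (C / sqrt c / x)) with (C / x) by (field; lra).
    apply Rle_trans with (2 := Hph). apply Rmult_le_compat_r; [apply Rabs_pos | trivial]. }
  destruct (near_sin_zero _ _ Hsin) as [j Hj].
  (* psi / PI = nu / 2 - 1/4; the shift by one makes the offset nu / 2 + 3/4, for which [j] will be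
     the index counted from 0. *)
  exists (j - 1)%Z. rewrite minus_IZR.
  replace (x - PI * (IZR j - 1 + (nu / 2 + 3 / 4))) with (x - psi - PI * IZR j)
    by (unfold psi; field).
  replace (4 * (C / sqrt c) / x) with (4 * (C / sqrt c / x)) by (field; lra). exact Hj.
Qed.

(** At a critical point u' = (delta + 1/2) u / x. Hence |u| is bounded below, and the sine term is
    itself O(1/x) relative to u, which forces cos(x - psi) = O(1/x). *)
Lemma critical_location (nu delta : R) : 0 <= nu ->
  exists C, 0 <= C /\ forall x, 1 <= x -> critical nu delta x ->
    exists j : Z, Rabs (x - PI * (IZR j + (nu / 2 + 1 / 4))) <= C / x.
Proof.
  intros Hnu. destruct (phase_bound nu Hnu) as [C [HC Hph]].
  destruct (osc_modulus_bounds nu Hnu) as (c & M & Hc & HM).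
  set (d := delta + 1 / 2).
  set (c' := c / (1 + d ^ 2)).
  assert (Hd : 0 <= d ^ 2) by apply pow2_ge_0.
  assert (Hc' : 0 < c') by (apply Rdiv_lt_0_compat; lra).
  assert (Hsc : 0 < sqrt c') by now apply sqrt_lt_R0.
  assert (HCc : 0 < C / sqrt c') by now apply Rdiv_lt_0_compat.
  assert (Had := Rabs_pos d).
  exists (4 * (C / sqrt c' + Rabs d)).
  split; [lra | ]. intros x Hx Hz.
  specialize (Hph x Hx). destruct (HM x Hx) as [Hl _].
  set (psi := PI / 2 * (nu - 1 / 2)) in *.
  assert (HV : osc1 nu x = d / x * osc nu x).
  { unfold osc, osc1, d. rewrite Hz.
    replace (Rpower x (1 / 2)) with (Rpower x (- (1 / 2)) * x).
    - field. lra.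
    - rewrite <- (Rpower_1 x) at 2 by lra. rewrite <- Rpower_plus. f_equal. field. }
  rewrite HV in Hph, Hl.
  assert (Hx2 : (d / x) ^ 2 <= d ^ 2).
  { unfold Rdiv. rewrite Rpow_mult_distr.
    assert (0 < / x <= 1).
    { split; [apply Rinv_0_lt_compat; lra | rewrite <- Rinv_1; apply Rinv_le_contravar; lra]. }
    assert ((/ x) ^ 2 <= 1) by (simpl; nra).
    rewrite <- (Rmult_1_r (d ^ 2)) at 2. now apply Rmult_le_compat_l. }
  assert (HU : sqrt c' <= Rabs (osc nu x)).
  { rewrite <- sqrt_Rsqr_abs. apply sqrt_le_1_alt. unfold c', Rsqr.
    apply Rmult_le_reg_r with (1 + d ^ 2); [lra | ].
    unfold Rdiv. rewrite Rmult_assoc, Rinv_l, Rmult_1_r by lra.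
    apply Rle_trans with (1 := Hl). generalize (pow2_ge_0 (osc nu x)). nra. }
  set (u := osc nu x) in *.
  assert (Hcos : Rabs (cos (x - psi)) <= (C / sqrt c' + Rabs d) / x).
  { apply Rmult_le_reg_l with (Rabs u); [lra | ].
    rewrite <- Rabs_mult.
    replace (u * cos (x - psi)) with (d / x * u * sin (x - psi)
      - (d / x * u * sin (x - psi) - u * cos (x - psi))) by ring.
    eapply Rle_trans; [apply Rabs_triang | ]. rewrite Rabs_Ropp.
    assert (H1 : Rabs (d / x * u * sin (x - psi)) <= Rabs u * (Rabs d / x)).
    { unfold Rdiv. rewrite !Rabs_mult, Rabs_inv, (Rabs_pos_eq x) by lra.
      assert (Rabs (sin (x - psi)) <= 1) by (apply Rabs_le, SIN_bound).
      assert (0 <= Rabs d * / x * Rabs u).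
      { apply Rmult_le_pos; [ | apply Rabs_pos]. apply Rmult_le_pos; trivial.
        apply Rlt_le, Rinv_0_lt_compat; lra. }
      generalize (Rabs_pos (sin (x - psi))). nra. }
    assert (H2 : C / x <= Rabs u * (C / sqrt c' / x)).
    { replace (C / x) with (sqrt c' * (C / sqrt c' / x)) by (field; lra).
      apply Rmult_le_compat_r; trivial. apply Rlt_le, Rdiv_lt_0_compat; lra. }
    replace (Rabs u * ((C / sqrt c' + Rabs d) / x))
      with (Rabs u * (Rabs d / x) + Rabs u * (C / sqrt c' / x)) by (field; lra).
    lra. }
  rewrite cos_sin in Hcos.
  destruct (near_sin_zero _ _ Hcos) as [j Hj].
  (* The cosine adds PI / 2 to the phase, so x is near PI (j + nu / 2 - 3/4), again shifted by
     one. *)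
  exists (j - 1)%Z. rewrite minus_IZR.
  replace (x - PI * (IZR j - 1 + (nu / 2 + 1 / 4)))
    with (PI / 2 + (x - psi) - PI * IZR j) by (unfold psi; field).
  replace (4 * (C / sqrt c' + Rabs d) / x) with (4 * ((C / sqrt c' + Rabs d) / x))
    by (field; lra). exact Hj.
Qed.

(** * From approximate locations to indices *)

Definition asymptotic (x : nat -> R) (a : R) : Prop :=
  exists C K, 0 <= C /\ forall n, (K <= n)%nat -> Rabs (x n - PI * (INR n + a)) <= C / INR (S n).

Lemma exists_nat_ge (M : R) : exists N : nat, forall n, (N <= n)%nat -> M <= INR n.
Proof.
  destruct (INR_unbounded M) as [N HN]. exists N. intros n Hn.
  apply le_INR in Hn. lra.
Qed.

(* Each [x n] is close to some [PI * (j + a)]; knowing it up to less than [PI] identifies [j]. *)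
Lemma index_pinning (x : nat -> R) (a d C D : R) (K : nat) :
  d < 1 -> 0 <= C -> 0 <= D ->
  (forall n, (K <= n)%nat -> Rabs (x n - PI * (INR n + a)) <= PI * d + D / INR (S n)) ->
  (forall n, (K <= n)%nat -> 1 <= x n ->
     exists j : Z, Rabs (x n - PI * (IZR j + a)) <= C / x n) ->
  asymptotic x a.
Proof.
  intros Hd HC HD Hloc Hj. assert (HPI := PI2_3_2).
  (* Beyond [N1], x(n) >= n + 1, so C / x(n) is at most C / (n + 1). Beyond [N2], the two errors add
     up to less than PI, which forces the integer found to be n. *)
  destruct (exists_nat_ge (4 * (Rabs a + 1) + D + 1)) as [N1 HN1].
  destruct (exists_nat_ge ((C + D) / (1 - d))) as [N2 HN2].
  exists C, (K + N1 + N2)%nat. split; trivial. intros n Hn.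
  specialize (HN1 n ltac:(lia)). specialize (HN2 n ltac:(lia)).
  specialize (Hloc n ltac:(lia)). specialize (Hj n ltac:(lia)).
  assert (Hn0 := pos_INR n). rewrite S_INR in *.
  assert (HDn : D / (INR n + 1) <= D).
  { apply Rmult_le_reg_r with (INR n + 1); [lra | ]. unfold Rdiv.
    rewrite Rmult_assoc, Rinv_l by lra. nra. }
  assert (Ha := Rle_abs (- a)). rewrite Rabs_Ropp in Ha.
  assert (Hxn : INR n + 1 <= x n).
  { apply Rabs_le_between in Hloc. assert (PI * d <= PI * 1) by (apply Rmult_le_compat_l; lra).
    assert (HPI4 := PI_4). assert (Habs := Rabs_pos a).
    assert (PI * (INR n - Rabs a - 1) <= PI * (INR n + a - 1)) by (apply Rmult_le_compat_l; lra).
    assert (3 * (INR n - Rabs a - 1) <= PI * (INR n - Rabs a - 1))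
      by (apply Rmult_le_compat_r; lra).
    lra. }
  destruct (Hj ltac:(lra)) as [j Hjj].
  assert (HCx : C / x n <= C / (INR n + 1)).
  { apply Rmult_le_compat_l; trivial. apply Rinv_le_contravar; lra. }
  assert (HCD : (C + D) / (INR n + 1) < 1 - d).
  { apply Rmult_lt_reg_r with ((INR n + 1) / (1 - d)); [apply Rdiv_lt_0_compat; lra | ].
    replace ((C + D) / (INR n + 1) * ((INR n + 1) / (1 - d))) with ((C + D) / (1 - d))
      by (field; lra).
    replace ((1 - d) * ((INR n + 1) / (1 - d))) with (INR n + 1) by (field; lra). lra. }
  assert (E : j = Z.of_nat n).
  { assert (Habs : Rabs (PI * (IZR j - INR n)) < PI).
    { replace (PI * (IZR j - INR n)) with ((x n - PI * (INR n + a)) - (x n - PI * (IZR j + a)))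
        by ring.
      eapply Rle_lt_trans; [apply Rabs_triang | ]. rewrite Rabs_Ropp.
      unfold Rdiv in *. rewrite Rmult_plus_distr_r in HCD.
      assert (PI * d + 1 * (1 - d) <= PI) by nra. lra. }
    rewrite Rabs_mult, (Rabs_pos_eq PI) in Habs by lra.
    assert (H1 : Rabs (IZR j - INR n) < 1).
    { apply Rmult_lt_reg_l with PI; lra. }
    rewrite INR_IZR_INZ, <- minus_IZR, <- abs_IZR in H1. apply lt_IZR in H1. lia. }
  rewrite E, <- INR_IZR_INZ in Hjj. lra.
Qed.

Definition zeros_asymptotic (nu : R) : Prop :=
  exists z, enumerates (fun x => cyl nu x = 0) z /\ asymptotic z (nu / 2 + 3 / 4).

Lemma critical_asymptotic (nu delta : R) : 0 <= nu -> delta <= nu -> zeros_asymptotic nu ->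
  exists c : nat -> R, asymptotic c (nu / 2 + 1 / 4) /\
    (delta < nu -> enumerates (critical nu delta) c) /\
    (delta = nu -> enumerates (critical nu delta) (fun n => c (S n))).
Proof.
  intros Hnu Hd (z & Hz & C & K & HC & HzC).
  destruct (critical_zeros_interlace nu delta z Hnu Hd Hz) as (c & Hc & H1 & H2).
  exists c. split; [ | now split].
  assert (Hcrit : forall k, critical nu delta (c (S k))).
  { intros k. destruct (Rlt_dec delta nu) as [H|H].
    - apply (consecutive_in _ _ (proj1 (H1 H))).
    - apply (consecutive_in _ _ (proj1 (H2 ltac:(lra)))). }
  destruct (critical_location nu delta Hnu) as [C' [HC' Hloc]].
  (* The predicted critical point is the midpoint of the two predicted zeros around it, whence d =
     1/2. The factor 2 comes from C / (k + 1) <= 2 C / (k + 2). *)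
  apply (index_pinning c _ (1 / 2) C' (2 * C) (S K)); try lra.
  - intros [|k] Hk; [lia | ]. specialize (Hc k).
    assert (G1 := HzC k ltac:(lia)). assert (G2 := HzC (S k) ltac:(lia)).
    rewrite !S_INR in *. assert (Hk0 := pos_INR k).
    assert (E1 : C / (INR k + 1) <= 2 * C / (INR k + 1 + 1)).
    { apply Rmult_le_reg_r with ((INR k + 1) * (INR k + 1 + 1)); [nra | ].
      replace (C / (INR k + 1) * ((INR k + 1) * (INR k + 1 + 1))) with (C * (INR k + 2))
        by (field; lra).
      replace (2 * C / (INR k + 1 + 1) * ((INR k + 1) * (INR k + 1 + 1)))
        with (C * (2 * INR k + 2)) by (field; lra). nra. }
    assert (E2 : C / (INR k + 1 + 1) <= 2 * C / (INR k + 1 + 1)).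
    { apply Rmult_le_compat_r; [apply Rlt_le, Rinv_0_lt_compat; lra | lra]. }
    apply Rabs_le_between in G1. apply Rabs_le_between in G2. apply Rabs_le. lra.
  - intros [|k] Hk Hx; [lia | ]. now apply Hloc.
Qed.

Lemma enumerates_ext (P Q : R -> Prop) (z : nat -> R) :
  (forall x, 0 < x -> P x <-> Q x) -> enumerates P z -> enumerates Q z.
Proof.
  intros H [H1 H2]. split; trivial. now apply (consecutive_ext P Q).
Qed.

(** With [delta = nu] the n-th zero of the next order is [c (S n)], and (n + 1) + nu / 2 + 1/4 = n +
    (nu + 1) / 2 + 3/4. *)
Lemma zeros_asymptotic_succ (nu : R) : 0 <= nu ->
  zeros_asymptotic nu -> zeros_asymptotic (nu + 1).
Proof.
  intros Hnu Hz. destruct (critical_asymptotic nu nu Hnu ltac:(lra) Hz) as (c & HA & _ & H).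
  exists (fun n => c (S n)). split.
  - apply (enumerates_ext (critical nu nu)); [ | now apply H].
    intros x Hx. now apply critical_self.
  - destruct HA as (C & K & HC & HA). exists C, K. split; trivial.
    intros n Hn. specialize (HA (S n) ltac:(lia)).
    rewrite !S_INR in *. assert (Hn0 := pos_INR n).
    replace (INR n + ((nu + 1) / 2 + 3 / 4)) with (INR n + 1 + (nu / 2 + 1 / 4)) by field.
    apply Rle_trans with (1 := HA). apply Rmult_le_compat_l; trivial.
    apply Rinv_le_contravar; lra.
Qed.

Lemma zeros_asymptotic_pred (nu : R) : 0 <= nu ->
  zeros_asymptotic (nu + 1) -> zeros_asymptotic nu.
Proof.
  intros Hnu Hz.
  destruct (critical_asymptotic (nu + 1) (- (nu + 1)) ltac:(lra) ltac:(lra) Hz) as (c & HA & H & _).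
  exists c. split.
  - apply (enumerates_ext (critical (nu + 1) (- (nu + 1)))); [ | apply H; lra].
    intros x Hx. now apply critical_opp.
  - now replace (nu / 2 + 3 / 4) with ((nu + 1) / 2 + 1 / 4) by field.
Qed.

Lemma half_zeros : enumerates (fun x => cyl (1 / 2) x = 0) (fun n => PI * INR (S n)).
Proof.
  assert (HPI := PI_RGT_0).
  apply (enumerates_ext (fun x => sin x = 0)).
  { intros x Hx. rewrite <- phi_half. unfold cyl.
    assert (0 < Rpower x (1 / 2)) by apply exp_pos.
    split; intros E; apply Rmult_integral in E; destruct E as [E|E]; try lra; rewrite E; ring. }
  assert (Hsin : forall n, sin (PI * INR n) = 0).
  { intros n. rewrite INR_IZR_INZ, Rmult_comm. apply sin_IZR_PI. }
  assert (Hgap : forall n x, PI * INR n < x < PI * INR (S n) -> sin x <> 0).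
  { intros n x Hx E. destruct (sin_eq_0_0 x E) as [k ->]. rewrite S_INR in Hx.
    rewrite INR_IZR_INZ in Hx.
    assert (H1 : IZR (Z.of_nat n) < IZR k) by nra.
    assert (H2 : IZR k < IZR (Z.of_nat n + 1)) by (rewrite plus_IZR; nra).
    apply lt_IZR in H1. apply lt_IZR in H2. lia. }
  split; [split | ].
  - simpl. lra.
  - intros n. rewrite (S_INR (S n)). lra.
  - intros n. apply Hsin.
  - intros x Hx. apply (Hgap O). simpl in *. lra.
  - intros n x Hx. now apply (Hgap (S n)).
  - intros M. destruct (INR_unbounded (M / PI)) as [n Hn]. exists n.
    rewrite S_INR. replace M with (PI * (M / PI)) by (field; lra).
    apply Rmult_lt_compat_l; lra.
Qed.

Lemma zeros_asymptotic_half : zeros_asymptotic (1 / 2).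
Proof.
  exists (fun n => PI * INR (S n)). split; [apply half_zeros | ].
  exists 0, O. split; [lra | ]. intros n _. rewrite S_INR.
  replace (PI * (INR n + 1) - PI * (INR n + (1 / 2 / 2 + 3 / 4))) with 0 by field.
  rewrite Rabs_R0. unfold Rdiv. lra.
Qed.

Lemma zeros_asymptotic_base (nu : R) : 1 / 2 <= nu <= 3 / 2 -> zeros_asymptotic nu.
Proof.
  intros Hnu.
  assert (H32 : zeros_asymptotic (3 / 2)).
  { replace (3 / 2) with (1 / 2 + 1) by field. apply zeros_asymptotic_succ; [lra | ].
    apply zeros_asymptotic_half. }
  destruct (Req_dec nu (1 / 2)) as [->|H1]; [apply zeros_asymptotic_half | ].
  destruct (Req_dec nu (3 / 2)) as [->|H3]; [trivial | ].
  destruct H32 as (z' & Hz' & C & K & HC & HA).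
  (* Zeros of order [nu] exist by comparison with order 3/2; comparison with order 1/2 then bounds
     them below by PI (n + 1), so they are unbounded. *)
  destruct (consecutive_zeros_exist nu (3 / 2) z') as [z Hz]; trivial; [lra | ].
  assert (Hle := zeros_below nu (3 / 2) z z' ltac:(lra) Hz (proj1 Hz')).
  assert (Hge := zeros_below (1 / 2) nu _ z ltac:(lra) (proj1 half_zeros) Hz).
  cbv beta in Hge.
  assert (HPI := PI_RGT_0).
  exists z. split.
  - split; trivial. intros M. destruct (proj2 half_zeros M) as [n Hn]. exists n.
    specialize (Hge n). lra.
  - destruct (zero_location nu ltac:(lra)) as [C' [HC' Hloc]].
    (* Both z(n), up to C / (n + 1), and its predicted value PI (n + nu / 2 + 3/4) lie between PI (n
       + 1) and PI (n + 3/2). *)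
    apply (index_pinning z _ (1 / 2) C' C K); try lra.
    + intros n Hn. specialize (HA n Hn). specialize (Hle n). specialize (Hge n).
      apply Rabs_le_between in HA. rewrite S_INR in *. assert (Hn0 := pos_INR n).
      assert (0 <= C / (INR n + 1)) by (apply Rdiv_le_0_compat; lra).
      assert (PI * (1 / 2) <= PI * nu <= PI * (3 / 2)) by (split; apply Rmult_le_compat_l; lra).
      apply Rabs_le. lra.
    + intros n Hn Hx. apply Hloc; trivial. apply (consecutive_in _ _ Hz).
Qed.

Lemma zeros_asymptotic_all (nu : R) : 0 <= nu -> zeros_asymptotic nu.
Proof.
  assert (Hup : forall n nu, 1 / 2 <= nu <= 3 / 2 + INR n -> zeros_asymptotic nu).
  { induction n as [|n IH]; intros mu Hmu.
    - apply zeros_asymptotic_base. simpl in Hmu. lra.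
    - rewrite S_INR in Hmu. destruct (Rle_dec mu (3 / 2)) as [H|H].
      + apply zeros_asymptotic_base. lra.
      + replace mu with (mu - 1 + 1) by ring. apply zeros_asymptotic_succ; [lra | ].
        apply IH. lra. }
  intros Hnu. destruct (Rle_dec (1 / 2) nu) as [H|H].
  - destruct (INR_unbounded nu) as [n Hn]. apply (Hup n). lra.
  - apply zeros_asymptotic_pred; trivial. apply (Hup O). simpl. lra.
Qed.

Theorem theorem4p11 (delta nu : R) (hnu : Rabs delta <= nu) :
  exists (C : R) (K : nat), forall k : nat, (K < k)%nat ->
    Rabs (aprime nu delta k - PI * (INR k + nu / 2 + 1 / 4)) <= C / INR k.
Proof.
  assert (Hnu : 0 <= nu) by (generalize (Rabs_pos delta); lra).
  assert (Hd : delta <= nu) by (generalize (Rle_abs delta); lra).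
  destruct (critical_asymptotic nu delta Hnu Hd (zeros_asymptotic_all nu Hnu))
    as (c & (C & K & HC & HA) & H1 & H2).
  assert (Hext : forall x, 0 < x -> critical nu delta x <-> is_derive (besselj nu delta) x 0).
  { intros x Hx. symmetry. now apply is_derive_besselj_0. }
  exists C, K. intros k Hk.
  assert (E : aprime nu delta k = c k).
  { unfold aprime, first_index. destruct (Req_EM_T nu delta) as [He|He].
    (* Here [first_index] is 1, and k > 0 makes S (k - 1) equal to k, so the arbitrary term [c 0] is
       never reached. *)
    - rewrite (crit_enumerated nu delta (fun n => c (S n))).
      + f_equal. lia.
      + apply (consecutive_ext _ _ _ Hext), H2. now symmetry.
    - rewrite (crit_enumerated nu delta c).
      + f_equal. lia.
      + apply (consecutive_ext _ _ _ Hext), H1. lra. }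
  rewrite E. specialize (HA k ltac:(lia)).
  replace (INR k + nu / 2 + 1 / 4) with (INR k + (nu / 2 + 1 / 4)) by ring.
  apply Rle_trans with (1 := HA). apply Rmult_le_compat_l; trivial.
  rewrite S_INR. apply Rinv_le_contravar; [apply lt_0_INR; lia | lra].
Qed.
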